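(* Let $G$ be a finite group, $p$ a prime, $(K,\mathcal{O},F)$ a $p$-modular system, $S$ a Sylow $p$-subgroup of $G$ and $\mathcal{F}:=\mathcal{F}_S(G)$ the resulting fusion system on $S$. There exists a ring homomorphism $t_S^G\colon B(\mathcal{F})\to B(G)$ such that the compositions $$\mathrm{res}^G_S\circ t_S^G\colon B(\mathcal{F})\to B(G)\to B(\mathcal{F})$$ and $$\lambda_S^{-1}\circ\mathrm{res}^G_S\circ\lambda_G\circ t_S^G\colon B(\mathcal{F})\to B(G)\to T(\mathcal{O}G)\to T(\mathcal{O}S)\xrightarrow{\sim}B(S)$$ are equal to the identity map on $B(\mathcal{F})$ (the second composition taking values in the subring $B(\mathcal{F})\subseteq B(S)$). In particular, one obtains decompositions $$B(G)=\ker(\mathrm{res}^G_S)\oplus t_S^G(B(\mathcal{F}))\quad\text{and}\quad T(\mathcal{O}G)=\ker(\lambda_S^{-1}\circ\mathrm{res}^G_S)\oplus(\lambda_G\circ t_S^G)(B(\mathcal{F}))$$ into ideals $\ker(\mathrm{res}^G_S)$ of $B(G)$ and $\ker(\lambda_S^{-1}\circ\mathrm{res}^G_S)$ of $T(\mathcal{O}G)$ and subrings isomorphic to $B(\mathcal{F})$.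
   Context: $p$-modular system: $\mathcal{O}$ is a complete discrete valuation ring with residue field $F$ of characteristic $p$ and field of fractions $K$ of characteristic $0$. $B(G)$ is the Burnside ring of $G$ (Grothendieck ring of finite $G$-sets under disjoint union and direct product). $B(\mathcal{F})$ is the subring of $B(S)$ consisting of all $a\in B(S)$ such that $\phi_P(a)=\phi_Q(a)$ whenever $P$ and $Q$ are $G$-conjugate subgroups of $S$, where $\phi_P\colon B(S)\to\mathbb{Z}$ is the ring homomorphism with $\phi_P([X])=|X^P|$ for finite $S$-sets $X$. A $p$-permutation $\mathcal{O}G$-module is a finitely generated $\mathcal{O}G$-module isomorphic to a direct summand of a finitely generated permutation $\mathcal{O}G$-module. $T(\mathcal{O}G)$ (the trivial source ring) is the Grothendieck group of the monoid of isomorphism classes of $p$-permutation $\mathcal{O}G$-modules under direct sum, with multiplication induced by $-\otimes_{\mathcal{O}}-$. $\lambda_G\colon B(G)\to T(\mathcal{O}G)$ is the ring homomorphism induced by sending a finite $G$-set $X$ to the permutation module $\mathcal{O}X$; since $S$ is a $p$-group, $\lambda_S\colon B(S)\to T(\mathcal{O}S)$ is a ring isomorphism. $\mathrm{res}^G_S$ denotes the restriction maps $B(G)\to B(S)$ and $T(\mathcal{O}G)\to T(\mathcal{O}S)$. The images of $\mathrm{res}^G_S\colon B(G)\to B(S)$ and $\lambda_S^{-1}\circ\mathrm{res}^G_S\colon T(\mathcal{O}G)\to B(S)$ are contained in $B(\mathcal{F})$. *)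

(* Defs.v *)
From HB Require Import structures.
From mathcomp Require Import all_boot all_order all_algebra all_fingroup all_solvable.
From mathcomp Require Import boolp classical_sets.
From mathcomp Require Import ring.
Set Implicit Arguments.
Unset Strict Implicit.
Unset Printing Implicit Defensive.
Import GRing.Theory.
Local Open Scope ring_scope.
Local Open Scope quotient_scope.

Local Notation repr := generic_quotient.repr.

Section Groth.
Variable A : comPzSemiRingType.
Implicit Types x y z : A * A.

Definition groth_eq x y := `[< exists k, x.1 + y.2 + k = y.1 + x.2 + k >].

Lemma groth_eq_equiv : equiv_class_of groth_eq.
Proof.
split=> [x|x y|y x z].
- by apply/asboolP; exists 0.
- by apply: asbool_equiv_eq; split=> -[k e]; exists k.
- move=> /asboolP[k e] /asboolP[l f]; apply/asboolP; exists (y.2 + k + l + y.1).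
  have -> : x.1 + z.2 + (y.2 + k + l + y.1) =
            (x.1 + y.2 + k) + (y.1 + z.2 + l) by ring.
  by rewrite e f; ring.
Qed.
Canonical groth_equivrel := EquivRelPack groth_eq_equiv.

(** The class of the pair (a, b) stands for the formal difference a - b. *)
Definition groth := {eq_quot groth_equivrel}.
HB.instance Definition _ := Choice.on groth.
HB.instance Definition _ := EqQuotient.on groth.

Lemma groth_piP x y :
  \pi_groth x = \pi_groth y <-> exists k, x.1 + y.2 + k = y.1 + x.2 + k.
Proof. by split=> [/eqquotP/asboolP|h]; last by apply/eqquotP/asboolP. Qed.

Lemma groth_repr x :
  exists k, (repr (\pi_groth x)).1 + x.2 + k = x.1 + (repr (\pi_groth x)).2 + k.
Proof. by apply/groth_piP; rewrite reprK. Qed.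

Definition groth_add (u v : groth) : groth :=
  \pi_groth ((repr u).1 + (repr v).1, (repr u).2 + (repr v).2).
Definition groth_opp (u : groth) : groth := \pi_groth ((repr u).2, (repr u).1).
Definition groth_mul (u v : groth) : groth :=
  \pi_groth ((repr u).1 * (repr v).1 + (repr u).2 * (repr v).2,
             (repr u).1 * (repr v).2 + (repr u).2 * (repr v).1).

Lemma groth_addE x y :
  groth_add (\pi_groth x) (\pi_groth y) = \pi_groth (x.1 + y.1, x.2 + y.2).
Proof.
apply/groth_piP; have [k e] := groth_repr x; have [l f] := groth_repr y.
move: (repr (\pi_groth x)) (repr (\pi_groth y)) e f => a b e f; exists (k + l) => /=.
have -> : a.1 + b.1 + (x.2 + y.2) + (k + l) =
          (a.1 + x.2 + k) + (b.1 + y.2 + l) by ring.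
by rewrite e f; ring.
Qed.

Lemma groth_oppE x : groth_opp (\pi_groth x) = \pi_groth (x.2, x.1).
Proof.
apply/groth_piP; have [k e] := groth_repr x.
by move: (repr _) e => a e; exists k; rewrite /= [_ + x.1]addrC -e [x.2 + _]addrC.
Qed.

Lemma groth_mulE x y : groth_mul (\pi_groth x) (\pi_groth y) =
  \pi_groth (x.1 * y.1 + x.2 * y.2, x.1 * y.2 + x.2 * y.1).
Proof.
apply/groth_piP; have [k e] := groth_repr x; have [l f] := groth_repr y.
move: (repr (\pi_groth x)) (repr (\pi_groth y)) e f => a b e f /=.
exists (k * b.1 + k * b.2 + x.1 * b.2 + x.2 * b.1 + x.1 * b.1 + x.2 * b.2 +
        x.1 * l + x.2 * l).
have -> : a.1 * b.1 + a.2 * b.2 + (x.1 * y.2 + x.2 * y.1) +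
   (k * b.1 + k * b.2 + x.1 * b.2 + x.2 * b.1 + x.1 * b.1 + x.2 * b.2 +
    x.1 * l + x.2 * l) =
   (a.1 + x.2 + k) * b.1 + (x.1 + a.2 + k) * b.2 +
   x.1 * (b.1 + y.2 + l) + x.2 * (y.1 + b.2 + l) by ring.
have -> : x.1 * y.1 + x.2 * y.2 + (a.1 * b.2 + a.2 * b.1) +
   (k * b.1 + k * b.2 + x.1 * b.2 + x.2 * b.1 + x.1 * b.1 + x.2 * b.2 +
    x.1 * l + x.2 * l) =
   (x.1 + a.2 + k) * b.1 + (a.1 + x.2 + k) * b.2 +
   x.1 * (y.1 + b.2 + l) + x.2 * (b.1 + y.2 + l) by ring.
by rewrite e f.
Qed.

Lemma grothP (u : groth) : exists x, u = \pi_groth x.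
Proof. by exists (repr u); rewrite reprK. Qed.

Lemma groth_addA : associative groth_add.
Proof.
move=> u v w; have [x ->] := grothP u; have [y ->] := grothP v.
have [z ->] := grothP w; rewrite !groth_addE /=.
by congr (\pi_groth (_, _)); rewrite addrA.
Qed.
Lemma groth_addC : commutative groth_add.
Proof.
move=> u v; have [x ->] := grothP u; have [y ->] := grothP v.
by rewrite !groth_addE; congr (\pi_groth (_, _)); rewrite addrC.
Qed.
Lemma groth_add0 : left_id (\pi_groth (0, 0)) groth_add.
Proof.
move=> u; have [x ->] := grothP u.
by rewrite groth_addE; case: x => a b; congr (\pi_groth (_, _)); rewrite add0r.
Qed.
Lemma groth_addN : left_inverse (\pi_groth (0, 0)) groth_opp groth_add.
Proof.
move=> u; have [x ->] := grothP u; rewrite groth_oppE groth_addE.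
by apply/groth_piP; exists 0 => /=; ring.
Qed.
Lemma groth_mulA : associative groth_mul.
Proof.
move=> u v w; have [x ->] := grothP u; have [y ->] := grothP v.
have [z ->] := grothP w; rewrite !groth_mulE /=.
by congr (\pi_groth (_, _)); ring.
Qed.
Lemma groth_mulC : commutative groth_mul.
Proof.
move=> u v; have [x ->] := grothP u; have [y ->] := grothP v.
by rewrite !groth_mulE; congr (\pi_groth (_, _)); ring.
Qed.
Lemma groth_mul1 : left_id (\pi_groth (1, 0)) groth_mul.
Proof.
move=> u; have [x ->] := grothP u.
by rewrite groth_mulE; case: x => a b /=; congr (\pi_groth (_, _)); ring.
Qed.
Lemma groth_mulDl : left_distributive groth_mul groth_add.
Proof.
move=> u v w; have [x ->] := grothP u; have [y ->] := grothP v.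
have [z ->] := grothP w; rewrite !(groth_mulE, groth_addE) /=.
by congr (\pi_groth (_, _)); ring.
Qed.

HB.instance Definition _ :=
  GRing.isZmodule.Build groth groth_addA groth_addC groth_add0 groth_addN.
HB.instance Definition _ := GRing.Zmodule_isComPzRing.Build groth
  groth_mulA groth_mulC groth_mul1 groth_mulDl.

Definition groth_in (a : A) : groth := \pi_groth (a, 0).

Lemma groth_inD a b : groth_in (a + b) = groth_in a + groth_in b.
Proof. by rewrite [RHS]groth_addE /= addr0. Qed.

Lemma groth_inM a b : groth_in (a * b) = groth_in a * groth_in b.
Proof. by rewrite [RHS]groth_mulE /= !mulr0 mul0r !addr0. Qed.

Lemma groth_in0 : groth_in 0 = 0. Proof. by []. Qed.
Lemma groth_in1 : groth_in 1 = 1. Proof. by []. Qed.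

Lemma grothBE (u : groth) : exists a b, u = groth_in a - groth_in b.
Proof.
have [[a b] ->] := grothP u; exists a, b.
by rewrite [- _]groth_oppE [RHS]groth_addE /= addr0 add0r.
Qed.

Lemma groth_in_eq a b : groth_in a = groth_in b <-> exists k, a + k = b + k.
Proof. by rewrite groth_piP /=; split=> -[k e]; exists k; move: e; rewrite !addr0. Qed.

Section Lift.
Variables (R : comPzRingType) (f : A -> R).
Hypotheses (f0 : f 0 = 0) (fD : {morph f : a b / a + b}).
Hypotheses (f1 : f 1 = 1) (fM : {morph f : a b / a * b}).

Definition groth_lift_fun (u : groth) : R := f (repr u).1 - f (repr u).2.

Lemma groth_lift_pi x : groth_lift_fun (\pi_groth x) = f x.1 - f x.2.
Proof.
rewrite /groth_lift_fun; have [k e] := groth_repr x.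
move: (repr _) e => a e; have /eqP := congr1 f e.
rewrite !fD (inj_eq (addIr _)) => /eqP e'; apply/eqP.
by rewrite subr_eq addrAC -e' addrK.
Qed.

Lemma groth_lift_zmod : zmod_morphism groth_lift_fun.
Proof.
move=> u v; have [x ->] := grothP u; have [y ->] := grothP v.
rewrite [- _]groth_oppE [X in groth_lift_fun X]groth_addE !groth_lift_pi /= !fD; ring.
Qed.
Lemma groth_lift_mon : monoid_morphism groth_lift_fun.
Proof.
split=> [|u v]; first by rewrite groth_lift_pi /= f1 f0 subr0.
have [x ->] := grothP u; have [y ->] := grothP v.
rewrite [X in groth_lift_fun X]groth_mulE !groth_lift_pi /= !(fD, fM); ring.
Qed.
HB.instance Definition _ :=
  GRing.isZmodMorphism.Build groth R groth_lift_fun groth_lift_zmod.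
HB.instance Definition _ :=
  GRing.isMonoidMorphism.Build groth R groth_lift_fun groth_lift_mon.
Definition groth_lift : {rmorphism groth -> R} := groth_lift_fun.

Lemma groth_lift_in a : groth_lift (groth_in a) = f a.
Proof. by rewrite [LHS]groth_lift_pi /= f0 subr0. Qed.
End Lift.
End Groth.

(** A category with sums and products, remembered up to isomorphism only.
    Finite G-sets and modules live in too large a universe to be the carrier of
    a ring, so [rc_sk] is a small type with a representative of each isomorphism
    class; an isomorphism class is then recorded as the set of its
    representatives in [rc_sk] (see [cls_eq] and [cls_surj] below). *)
Record rig_cat := RigCat {
  rc_ob :> Type;
  rc_iso : rc_ob -> rc_ob -> Prop;
  rc_zero : rc_ob;
  rc_one : rc_ob;
  rc_sum : rc_ob -> rc_ob -> rc_ob;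
  rc_prod : rc_ob -> rc_ob -> rc_ob;
  rc_sk : Type;
  rc_emb : rc_sk -> rc_ob;
  rc_dense : forall X, exists s, rc_iso X (rc_emb s);
  rc_refl : forall X, rc_iso X X;
  rc_sym : forall X Y, rc_iso X Y -> rc_iso Y X;
  rc_trans : forall X Y Z, rc_iso X Y -> rc_iso Y Z -> rc_iso X Z;
  rc_sum_iso : forall X X' Y Y', rc_iso X X' -> rc_iso Y Y' ->
    rc_iso (rc_sum X Y) (rc_sum X' Y');
  rc_prod_iso : forall X X' Y Y', rc_iso X X' -> rc_iso Y Y' ->
    rc_iso (rc_prod X Y) (rc_prod X' Y');
  rc_sumA : forall X Y Z,
    rc_iso (rc_sum X (rc_sum Y Z)) (rc_sum (rc_sum X Y) Z);
  rc_sumC : forall X Y, rc_iso (rc_sum X Y) (rc_sum Y X);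
  rc_sum0 : forall X, rc_iso (rc_sum rc_zero X) X;
  rc_prodA : forall X Y Z,
    rc_iso (rc_prod X (rc_prod Y Z)) (rc_prod (rc_prod X Y) Z);
  rc_prodC : forall X Y, rc_iso (rc_prod X Y) (rc_prod Y X);
  rc_prod1 : forall X, rc_iso (rc_prod rc_one X) X;
  rc_prodDl : forall X Y Z,
    rc_iso (rc_prod (rc_sum X Y) Z) (rc_sum (rc_prod X Z) (rc_prod Y Z));
  rc_prod0 : forall X, rc_iso (rc_prod rc_zero X) rc_zero }.

Section IsoClasses.
Variable C : rig_cat.
Implicit Types X Y Z : C.

Definition iso_set X : set (rc_sk C) := [set s | rc_iso X (rc_emb s)].

Record iso_class := IsoClass {
  iso_class_set :> set (rc_sk C);
  iso_classP : exists X, iso_class_set = iso_set X }.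

HB.instance Definition _ := gen_eqMixin iso_class.
HB.instance Definition _ := gen_choiceMixin iso_class.

Definition cls X : iso_class := IsoClass (ex_intro _ X erefl).

Lemma cls_eq X Y : cls X = cls Y <-> rc_iso X Y.
Proof.
split=> [e|i].
  have [s Xs] := rc_dense X; apply: (rc_trans Xs); apply: rc_sym.
  have : iso_set X s by [].
  by rewrite -[iso_set X]/(iso_class_set (cls X)) e.
have E : iso_set X = iso_set Y.
  apply/funext => s; apply/propext; split; apply: rc_trans => //.
  exact: rc_sym.
rewrite /cls; move: (ex_intro _ X _) (ex_intro _ Y _).
by rewrite E => p q; congr IsoClass; apply: Prop_irrelevance.
Qed.

Lemma cls_surj (c : iso_class) : exists X, c = cls X.
Proof.
case: c => A [X e]; exists X; subst A.
by congr IsoClass; apply: Prop_irrelevance.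
Qed.

Definition cls_ob (c : iso_class) : C := projT1 (cid (cls_surj c)).

Lemma cls_obK c : cls (cls_ob c) = c.
Proof. by rewrite /cls_ob; case: cid => /= X ->. Qed.

Lemma cls_ob_iso X : rc_iso (cls_ob (cls X)) X.
Proof. by apply/cls_eq; rewrite cls_obK. Qed.

Definition cls_add c d := cls (rc_sum (cls_ob c) (cls_ob d)).
Definition cls_mul c d := cls (rc_prod (cls_ob c) (cls_ob d)).

Lemma cls_addE X Y : cls_add (cls X) (cls Y) = cls (rc_sum X Y).
Proof. by apply/cls_eq/rc_sum_iso; apply: cls_ob_iso. Qed.
Lemma cls_mulE X Y : cls_mul (cls X) (cls Y) = cls (rc_prod X Y).
Proof. by apply/cls_eq/rc_prod_iso; apply: cls_ob_iso. Qed.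

Local Ltac lift_cls := repeat (move=> ?); repeat match goal with
  c : iso_class |- _ => let X := fresh "X" in have [X ->] := cls_surj c; clear c
  end; rewrite ?(cls_addE, cls_mulE); apply/cls_eq.

Lemma cls_addA : associative cls_add.
Proof. by lift_cls; apply: rc_sumA. Qed.
Lemma cls_addC : commutative cls_add.
Proof. by lift_cls; apply: rc_sumC. Qed.
Lemma cls_add0 : left_id (cls (rc_zero C)) cls_add.
Proof. by lift_cls; apply: rc_sum0. Qed.
Lemma cls_mulA : associative cls_mul.
Proof. by lift_cls; apply: rc_prodA. Qed.
Lemma cls_mulC : commutative cls_mul.
Proof. by lift_cls; apply: rc_prodC. Qed.
Lemma cls_mul1 : left_id (cls (rc_one C)) cls_mul.
Proof. by lift_cls; apply: rc_prod1. Qed.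
Lemma cls_mulDl : left_distributive cls_mul cls_add.
Proof. by lift_cls; apply: rc_prodDl. Qed.
Lemma cls_mul0 : left_zero (cls (rc_zero C)) cls_mul.
Proof. by lift_cls; apply: rc_prod0. Qed.

HB.instance Definition _ :=
  GRing.isNmodule.Build iso_class cls_addA cls_addC cls_add0.
HB.instance Definition _ := GRing.Nmodule_isComPzSemiRing.Build iso_class
  cls_mulA cls_mulC cls_mul1 cls_mulDl cls_mul0.

Definition groth_ring : comPzRingType := groth iso_class.
(** The class [X] in the Grothendieck ring; see [gclsBE] and [gcls_eq]. *)
Definition gcls X : groth_ring := groth_in (cls X).

Lemma gcls_iso X Y : rc_iso X Y -> gcls X = gcls Y.
Proof. by move=> /cls_eq; rewrite /gcls => ->. Qed.
Lemma gcls_eq X Y :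
  gcls X = gcls Y <-> exists Z, rc_iso (rc_sum X Z) (rc_sum Y Z).
Proof.
rewrite groth_in_eq; split=> [[k]|[Z /cls_eq e]].
  by have [Z ->] := cls_surj k => e; exists Z; apply/cls_eq; rewrite -!cls_addE.
by exists (cls Z); rewrite -!cls_addE in e.
Qed.
Lemma gclsBE (u : groth_ring) : exists X Y, u = gcls X - gcls Y.
Proof.
have [c [d ->]] := grothBE u.
by have [X ->] := cls_surj c; have [Y ->] := cls_surj d; exists X, Y.
Qed.
Lemma gcls0 : gcls (rc_zero C) = 0. Proof. by []. Qed.
Lemma gcls1 : gcls (rc_one C) = 1. Proof. by []. Qed.
Lemma gclsD X Y : gcls (rc_sum X Y) = gcls X + gcls Y.
Proof. by rewrite -groth_inD /gcls -cls_addE. Qed.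
Lemma gclsM X Y : gcls (rc_prod X Y) = gcls X * gcls Y.
Proof. by rewrite -groth_inM /gcls -cls_mulE. Qed.

End IsoClasses.

Record rig_inv (C : rig_cat) (R : comPzRingType) := RigInv {
  ri_fun :> rc_ob C -> R;
  ri_iso : forall X Y, rc_iso X Y -> ri_fun X = ri_fun Y;
  ri0 : ri_fun (rc_zero C) = 0;
  riD : forall X Y, ri_fun (rc_sum X Y) = ri_fun X + ri_fun Y;
  ri1 : ri_fun (rc_one C) = 1;
  riM : forall X Y, ri_fun (rc_prod X Y) = ri_fun X * ri_fun Y }.

Section RigInv.
Variables (C : rig_cat) (R : comPzRingType) (f : rig_inv C R).
Definition cls_inv (c : iso_class C) : R := f (cls_ob c).
Lemma cls_invE X : cls_inv (cls X) = f X.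
Proof. exact/ri_iso/cls_ob_iso. Qed.
Lemma cls_inv0 : cls_inv 0 = 0. Proof. by rewrite cls_invE ri0. Qed.
Lemma cls_inv1 : cls_inv 1 = 1. Proof. by rewrite cls_invE ri1. Qed.
Lemma cls_invD : {morph cls_inv : c d / c + d}.
Proof. by move=> c d; rewrite cls_invE riD. Qed.
Lemma cls_invM : {morph cls_inv : c d / c * d}.
Proof. by move=> c d; rewrite cls_invE riM. Qed.
Definition groth_ext : {rmorphism groth_ring C -> R} :=
  groth_lift cls_inv0 cls_invD cls_inv1 cls_invM.
Lemma groth_extE X : groth_ext (gcls X) = f X.
Proof. by rewrite groth_lift_in cls_invE. Qed.
End RigInv.

(** Groups act on the right, on sets and on modules, as everywhere in the
    library. *)
Record gset (gT : finGroupType) (G : {group gT}) :=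
  GSet { gset_sort :> finType; gset_act : action G gset_sort }.

Section GSets.
Variables (gT : finGroupType) (G : {group gT}).
Implicit Types X Y Z : gset G.
Local Open Scope group_scope.

Definition gset_iso X Y := exists f : X -> Y, bijective f /\
  {in G, forall g x, f (gset_act X x g) = gset_act Y (f x) g}.

Lemma gset_isoI X Y (f : X -> Y) (f' : Y -> X) :
  cancel f f' -> cancel f' f ->
  {in G, forall g x, f (gset_act X x g) = gset_act Y (f x) g} -> gset_iso X Y.
Proof. by move=> fK f'K fG; exists f; split=> //; exists f'. Qed.

Lemma gset_iso_inv X Y : gset_iso X Y -> exists (f : X -> Y) (f' : Y -> X),
  [/\ cancel f f', cancel f' f,
      {in G, forall g x, f (gset_act X x g) = gset_act Y (f x) g} &
      {in G, forall g y, f' (gset_act Y y g) = gset_act X (f' y) g}].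
Proof.
move=> [f [[f' fK f'K] fG]]; exists f, f'; split=> // g Gg y.
by rewrite -[in LHS](f'K y) -fG // fK.
Qed.

Definition triv_act (T : finType) (x : T) (g : gT) := x.
Lemma triv_is_action T : is_action G (@triv_act T).
Proof. by split=> [g x y|]. Qed.
Definition gset_triv T : gset G := GSet (Action (triv_is_action T)).

Section SumProd.
Variables X Y : gset G.
Definition sum_act (u : X + Y) (g : gT) : X + Y :=
  match u with inl x => inl (gset_act X x g) | inr y => inr (gset_act Y y g) end.
Lemma sum_is_action : is_action G sum_act.
Proof.
split=> [g [x|y] [x'|y'] //= [] /act_inj -> //|].
by move=> [x|y] g h Gg Gh /=; rewrite (actMin _ _ Gg Gh).
Qed.
Definition gset_sum : gset G := GSet (Action sum_is_action).

Definition prod_act (u : X * Y) (g : gT) : X * Y :=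
  (gset_act X u.1 g, gset_act Y u.2 g).
Lemma prod_is_action : is_action G prod_act.
Proof.
split=> [g [x y] [x' y'] [] /act_inj -> /act_inj -> //|].
by move=> [x y] g h Gg Gh; rewrite /prod_act /= !(actMin _ _ Gg Gh).
Qed.
Definition gset_prod : gset G := GSet (Action prod_is_action).
End SumProd.

Definition gset_sk : Type := {n : nat & action G 'I_n}.
Definition gset_emb (s : gset_sk) : gset G := GSet (projT2 s).

Section Small.
Variable X : gset G.
Definition rank_act (i : 'I_#|X|) (g : gT) : 'I_#|X| :=
  enum_rank (gset_act X (enum_val i) g).
Lemma rank_is_action : is_action G rank_act.
Proof.
split=> [g i j /enum_rank_inj /act_inj /enum_val_inj //|].
by move=> i g h Gg Gh; rewrite /rank_act enum_rankK (actMin _ _ Gg Gh).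
Qed.
Definition gset_small : gset_sk := existT _ #|X| (Action rank_is_action).
Lemma gset_smallP : gset_iso X (gset_emb gset_small).
Proof.
apply: (@gset_isoI X (gset_emb gset_small) enum_rank enum_val).
- exact: enum_rankK.
- exact: enum_valK.
- by move=> g Gg x /=; rewrite /rank_act enum_rankK.
Qed.
End Small.

Lemma gset_iso_refl X : gset_iso X X.
Proof. by apply: (@gset_isoI X X id id). Qed.
Lemma gset_iso_sym X Y : gset_iso X Y -> gset_iso Y X.
Proof. by move=> /gset_iso_inv[f [f' [fK f'K fG f'G]]]; apply: (gset_isoI f'K fK). Qed.
Lemma gset_iso_trans X Y Z : gset_iso X Y -> gset_iso Y Z -> gset_iso X Z.
Proof.
move=> [f [bf fG]] [h [bh hG]]; exists (h \o f); split; first exact: bij_comp.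
by move=> g Gg x /=; rewrite fG // hG.
Qed.

Lemma gset_dense X : exists s, gset_iso X (gset_emb s).
Proof. by exists (gset_small X); apply: gset_smallP. Qed.

Lemma gset_sum_iso X X' Y Y' : gset_iso X X' -> gset_iso Y Y' ->
  gset_iso (gset_sum X Y) (gset_sum X' Y').
Proof.
move=> /gset_iso_inv[f [f' [fK f'K fG f'G]]] /gset_iso_inv[h [h' [hK h'K hG h'G]]].
apply: (@gset_isoI (gset_sum X Y) (gset_sum X' Y')
  (fun u => match u with inl x => inl (f x) | inr y => inr (h y) end)
  (fun u => match u with inl x => inl (f' x) | inr y => inr (h' y) end)).
- by move=> [x|y]; rewrite ?fK ?hK.
- by move=> [x|y]; rewrite ?f'K ?h'K.
- by move=> g Gg [x|y] /=; rewrite ?fG ?hG.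
Qed.

Lemma gset_prod_iso X X' Y Y' : gset_iso X X' -> gset_iso Y Y' ->
  gset_iso (gset_prod X Y) (gset_prod X' Y').
Proof.
move=> /gset_iso_inv[f [f' [fK f'K fG f'G]]] /gset_iso_inv[h [h' [hK h'K hG h'G]]].
apply: (@gset_isoI (gset_prod X Y) (gset_prod X' Y')
  (fun u => (f u.1, h u.2)) (fun u => (f' u.1, h' u.2))).
- by move=> [x y]; rewrite /= fK hK.
- by move=> [x y]; rewrite /= f'K h'K.
- by move=> g Gg [x y]; rewrite /= /prod_act /= fG ?hG.
Qed.

Lemma gset_sumA X Y Z :
  gset_iso (gset_sum X (gset_sum Y Z)) (gset_sum (gset_sum X Y) Z).
Proof.
apply: (@gset_isoI (gset_sum X (gset_sum Y Z)) (gset_sum (gset_sum X Y) Z)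
  (fun u => match u with inl x => inl (inl x) | inr (inl y) => inl (inr y)
            | inr (inr z) => inr z end)
  (fun u => match u with inl (inl x) => inl x | inl (inr y) => inr (inl y)
            | inr z => inr (inr z) end)).
- by move=> [x|[y|z]].
- by move=> [[x|y]|z].
- by move=> g Gg [x|[y|z]].
Qed.

Lemma gset_sumC X Y : gset_iso (gset_sum X Y) (gset_sum Y X).
Proof.
apply: (@gset_isoI (gset_sum X Y) (gset_sum Y X)
  (fun u => match u with inl x => inr x | inr y => inl y end)
  (fun u => match u with inl x => inr x | inr y => inl y end)).
- by move=> [x|y].
- by move=> [x|y].
- by move=> g Gg [x|y].
Qed.

Lemma gset_sum0 X : gset_iso (gset_sum (gset_triv void) X) X.
Proof.
apply: (@gset_isoI (gset_sum (gset_triv void) X) X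
  (fun u => match u with inl x => of_void X x | inr y => y end) inr) => //.
- by move=> [[]|y].
- by move=> g Gg [[]|y].
Qed.

Lemma gset_prodA X Y Z :
  gset_iso (gset_prod X (gset_prod Y Z)) (gset_prod (gset_prod X Y) Z).
Proof.
apply: (@gset_isoI (gset_prod X (gset_prod Y Z)) (gset_prod (gset_prod X Y) Z)
  (fun u => ((u.1, u.2.1), u.2.2)) (fun u => (u.1.1, (u.1.2, u.2)))).
- by move=> [x [y z]].
- by move=> [[x y] z].
- by move=> g Gg [x [y z]].
Qed.

Lemma gset_prodC X Y : gset_iso (gset_prod X Y) (gset_prod Y X).
Proof.
apply: (@gset_isoI (gset_prod X Y) (gset_prod Y X)
  (fun u => (u.2, u.1)) (fun u => (u.2, u.1))).
- by move=> [x y].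
- by move=> [x y].
- by move=> g Gg [x y].
Qed.

Lemma gset_prod1 X : gset_iso (gset_prod (gset_triv unit) X) X.
Proof.
apply: (@gset_isoI (gset_prod (gset_triv unit) X) X snd (fun x => (tt, x))) => //.
by move=> [[] x].
Qed.

Lemma gset_prodDl X Y Z : gset_iso (gset_prod (gset_sum X Y) Z)
  (gset_sum (gset_prod X Z) (gset_prod Y Z)).
Proof.
apply: (@gset_isoI (gset_prod (gset_sum X Y) Z)
   (gset_sum (gset_prod X Z) (gset_prod Y Z))
  (fun u => match u.1 with inl x => inl (x, u.2) | inr y => inr (y, u.2) end)
  (fun u => match u with inl v => (inl v.1, v.2) | inr v => (inr v.1, v.2) end)).
- by move=> [[x|y] z].
- by move=> [[x z]|[y z]].
- by move=> g Gg [[x|y] z].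
Qed.

Lemma gset_prod0 X : gset_iso (gset_prod (gset_triv void) X) (gset_triv void).
Proof.
apply: (@gset_isoI (gset_prod (gset_triv void) X) (gset_triv void)
  fst (fun u => of_void _ u)) => //.
by move=> [[]].
Qed.

Definition gset_rig : rig_cat :=
  RigCat gset_dense gset_iso_refl gset_iso_sym gset_iso_trans gset_sum_iso
    gset_prod_iso gset_sumA gset_sumC gset_sum0 gset_prodA gset_prodC
    gset_prod1 gset_prodDl gset_prod0.

Definition burnside : comPzRingType := groth_ring gset_rig.

(** The mark of [P] is |X^P| when [P] is a subgroup of [G]; intersecting with
    [G] makes it total in [P], as [X] is only acted on by [G]. *)
Section Mark.
Variable P : {group gT}.

Definition fixpts X : {set X} := 'Fix_(gset_act X)(G :&: P).

Lemma fixptsP X x :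
  reflect {in G :&: P, forall g, gset_act X x g = x} (x \in fixpts X).
Proof. exact: afixP. Qed.

Definition mark_fun X : int := #|fixpts X|%:R%R.

Lemma mark_iso X Y : gset_iso X Y -> mark_fun X = mark_fun Y.
Proof.
move=> /gset_iso_inv[f [f' [fK f'K fG f'G]]]; congr (_%:R)%R.
rewrite -(card_imset _ (can_inj fK)); apply: eq_card => y; apply/imsetP/fixptsP.
  move=> [x /fixptsP xP ->] g gP; have /setIP[Gg _] := gP.
  by rewrite -fG // xP.
move=> yP; exists (f' y); last by rewrite f'K.
by apply/fixptsP => g gP; have /setIP[Gg _] := gP; rewrite -f'G // yP.
Qed.

Lemma mark0 : mark_fun (gset_triv void) = 0%R.
Proof. by rewrite /mark_fun eq_card0 // => -[]. Qed.

Lemma mark1 : mark_fun (gset_triv unit) = 1%R.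
Proof.
rewrite /mark_fun (_ : #|_| = 1%N) //; apply/eqP/cards1P; exists tt.
by apply/setP=> -[]; rewrite finset.in_set1 eqxx; apply/fixptsP.
Qed.

Lemma markD X Y : mark_fun (gset_sum X Y) = (mark_fun X + mark_fun Y)%R.
Proof.
have inlP u : (inl u \in fixpts (gset_sum X Y)) = (u \in fixpts X).
  apply/(fixptsP (X := gset_sum X Y))/fixptsP => h g gP.
    by have [] := h g gP.
  by rewrite /= h.
have inrP u : (inr u \in fixpts (gset_sum X Y)) = (u \in fixpts Y).
  apply/(fixptsP (X := gset_sum X Y))/fixptsP => h g gP.
    by have [] := h g gP.
  by rewrite /= h.
rewrite /mark_fun -natrD -!sum1_card big_sumType.
by rewrite (eq_bigl _ _ inlP) (eq_bigl _ _ inrP).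
Qed.

Lemma markM X Y : mark_fun (gset_prod X Y) = (mark_fun X * mark_fun Y)%R.
Proof.
rewrite /mark_fun -natrM -cardsX; congr (_%:R)%R; apply: eq_card => -[x y].
rewrite finset.in_setX; apply/fixptsP/andP => /=.
  by move=> h; split; apply/fixptsP => g gP; have [] := h g gP.
by move=> [/fixptsP hx /fixptsP hy] g gP; rewrite /prod_act /= hx ?hy.
Qed.

Definition mark : {rmorphism burnside -> int} :=
  groth_ext (@RigInv gset_rig int mark_fun mark_iso mark0 markD mark1 markM).

Lemma markE (X : gset_rig) : P \subset G ->
  mark (gcls X) = #|'Fix_(gset_act X)(P)|%:R%R.
Proof. by move=> sPG; rewrite groth_extE /= /mark_fun /fixpts (finset.setIidPr sPG). Qed.

End Mark.

End GSets.

Section ResBurnside.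
Variables (gT : finGroupType) (G H : {group gT}) (sHG : H \subset G).

Definition gset_res (X : gset G) : gset H :=
  GSet (gset_act X \ sHG)%act.

Definition res_gset_cls (X : gset_rig G) : burnside H :=
  @gcls (gset_rig H) (gset_res X).

Lemma res_gset_iso (X Y : gset_rig G) :
  rc_iso X Y -> res_gset_cls X = res_gset_cls Y.
Proof.
move=> [f [bf fG]]; apply: gcls_iso; exists f; split=> // g Hg x.
by apply: fG; apply: (fintype.subsetP sHG).
Qed.

Lemma res_gset0 : res_gset_cls (rc_zero (gset_rig G)) = 0.
Proof. by rewrite -gcls0; apply: gcls_iso; exists id; split=> //; exists id. Qed.

Lemma res_gset1 : res_gset_cls (rc_one (gset_rig G)) = 1.
Proof. by rewrite -gcls1; apply: gcls_iso; exists id; split=> //; exists id. Qed.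

Lemma res_gsetD (X Y : gset_rig G) :
  res_gset_cls (rc_sum X Y) = res_gset_cls X + res_gset_cls Y.
Proof. by rewrite -gclsD; apply: gcls_iso; exists id; split=> //; exists id. Qed.

Lemma res_gsetM (X Y : gset_rig G) :
  res_gset_cls (rc_prod X Y) = res_gset_cls X * res_gset_cls Y.
Proof. by rewrite -gclsM; apply: gcls_iso; exists id; split=> //; exists id. Qed.

Definition burnside_res : {rmorphism burnside G -> burnside H} :=
  groth_ext (RigInv res_gset_iso res_gset0 res_gsetD res_gset1 res_gsetM).

Lemma burnside_resE (X : gset G) :
  burnside_res (@gcls (gset_rig G) X) = @gcls (gset_rig H) (gset_res X).
Proof. exact: groth_extE. Qed.
End ResBurnside.

Section Modules.
Variables (O : comPzRingType) (gT : finGroupType) (G : {group gT}).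

(** As for [action], only the elements of [G] are required to act linearly. *)
Record ogmod := OGMod {
  ogm_sort :> lmodType O;
  ogm_act : ogm_sort -> gT -> ogm_sort;
  ogm_actL : {in G, forall g, linear (ogm_act^~ g)};
  ogm_act1 : forall m, ogm_act m 1%g = m;
  ogm_actM : {in G &, forall g h m, ogm_act m (g * h)%g = ogm_act (ogm_act m g) h} }.

Implicit Types M N L : ogmod.

Definition ogiso M N := exists f : M -> N, [/\ linear f, bijective f &
  {in G, forall g m, f (ogm_act m g) = ogm_act (f m) g}].

Lemma linear_inv (U V : lmodType O) (f : U -> V) (f' : V -> U) :
  linear f -> cancel f f' -> cancel f' f -> linear f'.
Proof. by move=> lf fK f'K a u v; apply: (can_inj fK); rewrite lf !f'K. Qed.

Lemma lin_comp (U V W : lmodType O) (f : U -> V) (h : V -> W) :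
  linear f -> linear h -> linear (h \o f).
Proof. by move=> lf lh a u v; rewrite /= lf lh. Qed.

Lemma ogisoI M N (f : M -> N) (f' : N -> M) :
  linear f -> cancel f f' -> cancel f' f ->
  {in G, forall g m, f (ogm_act m g) = ogm_act (f m) g} -> ogiso M N.
Proof. by move=> lf fK f'K fG; exists f; split=> //; exists f'. Qed.

Lemma ogiso_inv M N : ogiso M N -> exists (f : M -> N) (f' : N -> M),
  [/\ linear f /\ linear f', cancel f f' /\ cancel f' f,
      {in G, forall g m, f (ogm_act m g) = ogm_act (f m) g} &
      {in G, forall g m, f' (ogm_act m g) = ogm_act (f' m) g}].
Proof.
move=> [f [lf [f' fK f'K] fG]]; exists f, f'; split=> //.
  by split=> //; apply: linear_inv fK f'K.
by move=> g Gg m; rewrite -[in LHS](f'K m) -fG // fK.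
Qed.

Lemma ogiso_refl M : ogiso M M.
Proof. by apply: (@ogisoI M M id id). Qed.
Lemma ogiso_sym M N : ogiso M N -> ogiso N M.
Proof.
by move=> /ogiso_inv[f [f' [[_ lf'] [fK f'K] _ f'G]]]; apply: (ogisoI lf' f'K fK).
Qed.
Lemma ogiso_trans M N L : ogiso M N -> ogiso N L -> ogiso M L.
Proof.
move=> [f [lf bf fG]] [h [lh bh hG]]; exists (h \o f); split.
- exact: lin_comp.
- exact: bij_comp.
- by move=> g Gg m /=; rewrite fG // hG.
Qed.

Section DirectSum.
Variables M N : ogmod.
Definition dsum_act (u : M * N) (g : gT) : M * N := (ogm_act u.1 g, ogm_act u.2 g).
Lemma dsum_actL : {in G, forall g, linear (dsum_act^~ g)}.
Proof. by move=> g Gg a u v; rewrite /dsum_act /= !ogm_actL. Qed.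
Lemma dsum_act1 m : dsum_act m 1%g = m.
Proof. by case: m => m n; rewrite /dsum_act /= !ogm_act1. Qed.
Lemma dsum_actM :
  {in G &, forall g h m, dsum_act m (g * h)%g = dsum_act (dsum_act m g) h}.
Proof. by move=> g h Gg Gh m; rewrite /dsum_act /= !ogm_actM. Qed.
Definition ogm_dsum : ogmod := OGMod dsum_actL dsum_act1 dsum_actM.
End DirectSum.

(** The permutation module OX; the basis vector of x is the indicator function
    of x, so that the element [x] acted on by g is [x g]. *)
Section PermMod.
Variable X : gset G.
Definition perm_act (v : {ffun X -> O^o}) (g : gT) : {ffun X -> O^o} :=
  [ffun x => v (gset_act X x g^-1%g)].
Lemma perm_actL : {in G, forall g, linear (perm_act^~ g)}.
Proof. by move=> g Gg a u v; apply/ffunP=> x; rewrite !ffunE. Qed.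
Lemma perm_act1 v : perm_act v 1%g = v.
Proof. by apply/ffunP=> x; rewrite ffunE invg1 act1. Qed.
Lemma perm_actM :
  {in G &, forall g h v, perm_act v (g * h)%g = perm_act (perm_act v g) h}.
Proof.
by move=> g h Gg Gh v; apply/ffunP=> x; rewrite !ffunE invMg actMin ?groupV.
Qed.
Definition permMod : ogmod := OGMod perm_actL perm_act1 perm_actM.
End PermMod.

Definition fin_gen (M : lmodType O) := exists (I : finType) (e : I -> M),
  forall m, exists c : I -> O, m = \sum_i c i *: e i.

Definition p_permutation M :=
  fin_gen M /\ exists (X : gset G) (N : ogmod), ogiso (ogm_dsum M N) (permMod X).

Definition bilin (U V W : lmodType O) (b : U -> V -> W) :=
  (forall v, linear (b^~ v)) /\ (forall u, linear (b u)).

(** [L], with the diagonal action of [G], is the tensor product of [M] and [N]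
    over [O]. *)
Definition is_tensor M N L := exists b : M -> N -> L,
  [/\ bilin b,
      {in G, forall g m n, b (ogm_act m g) (ogm_act n g) = ogm_act (b m n) g},
      forall (V : lmodType O) (beta : M -> N -> V), bilin beta ->
        exists u : L -> V, linear u /\ forall m n, u (b m n) = beta m n &
      forall (V : lmodType O) (u u' : L -> V), linear u -> linear u' ->
        (forall m n, u (b m n) = u' (b m n)) -> u =1 u'].

Record pperm := PPerm { pp_mod :> ogmod; pp_modP : p_permutation pp_mod }.

Lemma lin0 (U V : lmodType O) (f : U -> V) : linear f -> f 0 = 0.
Proof. by move=> lf; have := lf (-1) 0 0; rewrite scaler0 addr0 scaleN1r addNr. Qed.
Lemma linD (U V : lmodType O) (f : U -> V) u v : linear f -> f (u + v) = f u + f v.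
Proof. by move=> lf; have := lf 1 u v; rewrite !scale1r. Qed.
Lemma linZ (U V : lmodType O) (f : U -> V) a u : linear f -> f (a *: u) = a *: f u.
Proof. by move=> lf; have := lf a u 0; rewrite (lin0 lf) !addr0. Qed.
Lemma linN (U V : lmodType O) (f : U -> V) u : linear f -> f (- u) = - f u.
Proof. by move=> lf; rewrite -scaleN1r linZ // scaleN1r. Qed.
Lemma lin_sum (U V : lmodType O) (f : U -> V) (I : finType) (c : I -> O) (e : I -> U) :
  linear f -> f (\sum_i c i *: e i) = \sum_i c i *: f (e i).
Proof.
move=> lf; elim/big_ind2: _ => [|u v u' v' <- <-|i _]; first exact: lin0.
  by rewrite linD.
by rewrite linZ.
Qed.

Section Tensor.

Lemma bilin_comp (U V W W' : lmodType O) (b : U -> V -> W) (f : W -> W') :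
  bilin b -> linear f -> bilin (fun u v => f (b u v)).
Proof.
move=> [bl br] lf; split=> [v|u] a x y /=.
  by rewrite (bl v) lf.
by rewrite (br u) lf.
Qed.

Lemma tensor_uniq M N L L' : is_tensor M N L -> is_tensor M N L' -> ogiso L L'.
Proof.
move=> [b [bb bG bu bun]] [b' [bb' b'G bu' bun']].
have [f [lf fb]] := bu L' b' bb'; have [f' [lf' fb']] := bu' L b bb.
apply: (ogisoI lf (f' := f')).
- have lc : linear (f' \o f) by apply: lin_comp.
  by apply: (bun _ (f' \o f) id lc) => // m n; rewrite /= fb fb'.
- have lc : linear (f \o f') by apply: lin_comp.
  by apply: (bun' _ (f \o f') id lc) => // m n; rewrite /= fb' fb.
- move=> g Gg; apply: (bun _ (fun x => f (ogm_act x g)) (fun x => ogm_act (f x) g)).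
  + by move=> a u v; rewrite ogm_actL // lf.
  + by move=> a u v; rewrite lf ogm_actL.
  + by move=> m n; rewrite -bG // !fb b'G.
Qed.

Lemma tensor_transp M N L M' N' :
  ogiso M M' -> ogiso N N' -> is_tensor M N L -> is_tensor M' N' L.
Proof.
move=> /ogiso_inv[f [f' [[lf lf'] [fK f'K] fG f'G]]].
move=> /ogiso_inv[h [h' [[lh lh'] [hK h'K] hG h'G]]].
move=> [b [[bl br] bG bu bun]]; exists (fun m n => b (f' m) (h' n)); split.
- by split=> [n|m] a u v /=; rewrite ?lf' ?lh' ?(bl (h' n)) ?(br (f' m)).
- by move=> g Gg m n; rewrite f'G // h'G // bG.
- move=> V beta [betal betar].
  have bb2 : bilin (fun m n => beta (f m) (h n)).
    by split=> [n|m] a u v /=; rewrite ?lf ?lh ?(betal (h n)) ?(betar (f m)).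
  have [u [lu ub]] := bu V _ bb2; exists u; split=> // m n.
  by rewrite ub f'K h'K.
- move=> V u u' lu lu' e; apply: bun => // m n.
  by have := e (f m) (h n); rewrite fK hK.
Qed.

Lemma tensorC M N L : is_tensor M N L -> is_tensor N M L.
Proof.
move=> [b [[bl br] bG bu bun]]; exists (fun n m => b m n); split=> //.
- by move=> g Gg m n; apply: bG.
- move=> V beta [betal betar].
  have [u [lu ub]] := bu V (fun m n => beta n m) (conj betar betal).
  by exists u.
- by move=> V u u' lu lu' e; apply: bun => // m n; apply: e.
Qed.

Lemma tensor1 M : is_tensor (permMod (gset_triv G unit)) M M.
Proof.
exists (fun (v : {ffun unit -> O^o}) (m : M) => (v tt : O) *: m); split.
- split=> [m|v] a u w; first by rewrite !ffunE scalerDl scalerA.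
  by rewrite scalerDr !scalerA mulrC.
- by move=> g Gg v m; rewrite ffunE /=; apply/esym/(linZ (f := fun m => ogm_act m g))/ogm_actL.
- move=> V beta [betal betar]; exists (beta ([ffun => 1] : {ffun unit -> O^o})); split; first exact: betar.
  move=> v m; rewrite linZ; last exact: betar.
  rewrite -(linZ (f := beta^~ m)); last exact: betal.
  by congr beta; apply/ffunP=> -[]; rewrite !ffunE /= -[LHS]/(_ * _) mulr1.
- move=> V u u' lu lu' e m; have := e ([ffun => 1] : {ffun unit -> O^o}) m.
  by rewrite ffunE scale1r.
Qed.

Lemma permMod_void (v w : permMod (gset_triv G void)) : v = w.
Proof. by apply/ffunP=> -[]. Qed.

Lemma tensor0 M : is_tensor (permMod (gset_triv G void)) M (permMod (gset_triv G void)).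
Proof.
exists (fun v m => 0); split.
- by split=> [m|v] a u w; apply: permMod_void.
- by move=> g Gg v m; apply: permMod_void.
- move=> V beta [betal betar]; exists (fun=> 0); split.
    by move=> a u v; rewrite scaler0 addr0.
  by move=> v m; rewrite (permMod_void v 0) (lin0 (f := beta^~ m)).
- by move=> V u u' lu lu' e m; rewrite (permMod_void m 0) !lin0.
Qed.

Lemma pairL (U V : lmodType O) a (u w : U) :
  (a *: u + w, 0) = a *: (u, 0) + (w, 0) :> U * V.
Proof. by rewrite [RHS]surjective_pairing /= scaler0 addr0. Qed.
Lemma pairR (U V : lmodType O) a (u w : V) :
  (0, a *: u + w) = a *: (0, u) + (0, w) :> U * V.
Proof. by rewrite [RHS]surjective_pairing /= scaler0 addr0. Qed.
Lemma pairLR (U V : lmodType O) (x : U) (y : V) :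
  (x, y) = (x, 0) + (0, y) :> U * V.
Proof. by rewrite [RHS]surjective_pairing /= addr0 add0r. Qed.

Lemma tensorDl M N Z L1 L2 : is_tensor M Z L1 -> is_tensor N Z L2 ->
  is_tensor (ogm_dsum M N) Z (ogm_dsum L1 L2).
Proof.
move=> [b [[bl br] bG bu bun]] [c [[cl cr] cG cu cun]].
exists (fun m z => (b m.1 z, c m.2 z)); split.
- split=> [z|m] a u w; first by rewrite (bl z) (cl z).
  by rewrite (br m.1) (cr m.2).
- by move=> g Gg m z; rewrite /= bG // cG.
- move=> V beta [betal betar].
  have b1 : bilin (fun m z => beta (m, 0) z).
    split=> [z|m]; last exact: betar.
    by move=> a u w; rewrite pairL (betal z).
  have b2 : bilin (fun n z => beta (0, n) z).
    split=> [z|m]; last exact: betar.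
    by move=> a u w; rewrite pairR (betal z).
  have [u [lu ub]] := bu V _ b1; have [w [lw wb]] := cu V _ b2.
  exists (fun x => u x.1 + w x.2); split.
    by move=> a x y /=; rewrite lu lw scalerDr addrACA.
  move=> [m n] z /=; rewrite ub wb -(linD (f := beta^~ z)) //.
  by rewrite -pairLR.
- move=> V u u' lu lu' e [x y].
  rewrite pairLR !linD //; congr (_ + _).
    apply: (bun V (fun x => u (x, 0)) (fun x => u' (x, 0))).
    + by move=> a p q; rewrite pairL lu.
    + by move=> a p q; rewrite pairL lu'.
    + by move=> m z; have := e (m, 0) z; rewrite /= (lin0 (f := c^~ z)).
  apply: (cun V (fun x => u (0, x)) (fun x => u' (0, x))).
  + by move=> a p q; rewrite pairR lu.
  + by move=> a p q; rewrite pairR lu'.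
  + by move=> m z; have := e (0, m) z; rewrite /= (lin0 (f := b^~ z)).
Qed.

Lemma tensorA M N Z A B L : is_tensor M N A -> is_tensor A Z L ->
  is_tensor N Z B -> is_tensor M B L.
Proof.
move=> [a [[al ar] aG au aun]] [l [[ll lr] lG lu lun]] [b [[bl br] bG bu bun]].
have H m : exists u : B -> L, linear u /\ forall n z, u (b n z) = l (a m n) z.
  apply: (bu L (fun n z => l (a m n) z)); split=> [z|n]; last exact: lr.
  by move=> k p q /=; rewrite (ar m) (ll z).
pose c m := projT1 (cid (H m)).
have cl m : linear (c m) by rewrite /c; case: cid => ? [].
have cb m n z : c m (b n z) = l (a m n) z by rewrite /c; case: cid => ? [].
exists c; split.
- split=> [x|//]; move=> k p q; move: x.
  apply: (bun L _ (fun x => k *: c p x + c q x)); first exact: cl.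
    move=> s x y; rewrite !cl !scalerDr !scalerA [k * s]mulrC addrACA.
    by [].
  by move=> n z; rewrite !cb (al n) (ll z).
- move=> g Gg m x; move: x.
  apply: (bun L (fun x => c (ogm_act m g) (ogm_act x g)) (fun x => ogm_act (c m x) g)).
  + by move=> s x y; rewrite ogm_actL // cl.
  + by move=> s x y; rewrite cl ogm_actL.
  + by move=> n z; rewrite -bG // !cb aG // lG.
- move=> V beta [betal betar].
  have K z : exists u : A -> V, linear u /\ forall m n, u (a m n) = beta m (b n z).
    apply: (au V (fun m n => beta m (b n z))); split=> [n|m]; first exact: betal.
    by move=> k p q /=; rewrite (bl z) (betar m).
  pose w z := projT1 (cid (K z)).
  have wl z : linear (w z) by rewrite /w; case: cid => ? [].
  have wa z m n : w z (a m n) = beta m (b n z) by rewrite /w; case: cid => ? [].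
  have wb : bilin (fun x z => w z x).
    split=> [z|x]; first exact: wl.
    move=> k p q; move: x.
    apply: (aun V _ (fun x => k *: w p x + w q x)); first exact: wl.
      by move=> s x y; rewrite !wl !scalerDr !scalerA [k * s]mulrC addrACA.
    by move=> m n; rewrite !wa (br n) (betar m).
  have [u [ul ub]] := lu V _ wb; exists u; split=> // m x; move: x.
  apply: (bun V (fun x => u (c m x)) (beta m)).
  + by move=> s x y; rewrite cl ul.
  + exact: betar.
  + by move=> n z; rewrite cb ub wa.
- move=> V u u' ul ul' e; apply: lun => // x z; move: x.
  apply: (aun V (fun x => u (l x z)) (fun x => u' (l x z))).
  + by move=> s x y; rewrite (ll z) ul.
  + by move=> s x y; rewrite (ll z) ul'.
  + by move=> m n; rewrite -cb e.
Qed.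

End Tensor.

Section Summands.

Definition mxapp (X Y : finType) (a : X -> Y -> O) (v : {ffun X -> O^o}) :
  {ffun Y -> O^o} := [ffun y => \sum_x (v x : O) * a x y].

Definition dlt (X : finType) (x : X) : {ffun X -> O^o} := [ffun y => (x == y)%:R].

Lemma mxapp_linear (X Y : finType) (a : X -> Y -> O) : linear (mxapp a).
Proof.
move=> k u v; apply/ffunP=> y; rewrite !ffunE scaler_sumr -big_split /=.
apply: eq_bigr => x _; rewrite !ffunE mulrDl; congr (_ + _).
exact: (esym (mulrA _ _ _)).
Qed.

Lemma mxapp_mul (X Y Z : finType) (a : X -> Y -> O) (b : Y -> Z -> O) v :
  mxapp b (mxapp a v) = mxapp (fun x z => \sum_y a x y * b y z) v.
Proof.
apply/ffunP=> z; rewrite !ffunE.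
under eq_bigr => y _ do rewrite ffunE mulr_suml.
rewrite exchange_big; apply: eq_bigr => x _; rewrite mulr_sumr.
by apply: eq_bigr => y _; rewrite mulrA.
Qed.

Lemma dlt_sum (X : finType) (v : {ffun X -> O^o}) :
  v = \sum_x (v x : O) *: dlt x.
Proof.
apply/ffunP=> y; rewrite sum_ffunE (bigD1 y) //= big1 => [|x /negPf nxy].
  by rewrite !ffunE eqxx addr0 -[RHS]/(_ * _) mulr1.
by rewrite !ffunE nxy scaler0.
Qed.

Lemma mxapp_dlt (X Y : finType) (a : X -> Y -> O) x y : mxapp a (dlt x) y = a x y.
Proof.
rewrite ffunE (bigD1 x) //= big1 => [|z /negPf nzx].
  by rewrite !ffunE eqxx mul1r addr0.
by rewrite ffunE eq_sym nzx mul0r.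
Qed.

Lemma mxapp_id (X : finType) (v : {ffun X -> O^o}) :
  mxapp (fun x y => (x == y)%:R) v = v.
Proof.
apply/ffunP=> y; rewrite ffunE (bigD1 y) //= big1 => [|z /negPf ->].
  by rewrite eqxx mulr1 addr0.
by rewrite mulr0.
Qed.

Lemma mxapp_act (X Y : gset G) (a : X -> Y -> O) :
  {in G, forall g x y, a (gset_act X x g) (gset_act Y y g) = a x y} ->
  {in G, forall g (v : permMod X), mxapp a (ogm_act v g) = ogm_act (mxapp a v : permMod Y) g}.
Proof.
move=> aG g Gg v; apply/ffunP=> y; rewrite !ffunE.
rewrite (reindex_inj (act_inj (gset_act X) g)) /=; apply: eq_bigr => x _.
rewrite ffunE -actMin ?groupV // mulgV act1.
rewrite -[in LHS](act1 (gset_act Y) y) -(mulVg g) actMin ?groupV //.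
by rewrite aG.
Qed.

(** A direct summand of the permutation module on [sm_set], as the image of an
    equivariant idempotent, given by its matrix. *)
Record summand := Summand {
  sm_set : gset G;
  sm_e : sm_set -> sm_set -> O;
  sm_idem : forall x z, \sum_y sm_e x y * sm_e y z = sm_e x z;
  sm_act : {in G, forall g x y,
    sm_e (gset_act sm_set x g) (gset_act sm_set y g) = sm_e x y} }.

Implicit Types s t : summand.

Definition sm_app s := mxapp (@sm_e s).
Arguments sm_app : clear implicits.

Lemma sm_app_linear s : linear (sm_app s).
Proof. exact: mxapp_linear. Qed.

Lemma sm_appK s v : sm_app s (sm_app s v) = sm_app s v.
Proof. by rewrite /sm_app mxapp_mul; congr (mxapp _ v); apply/funext=> x; apply/funext=> z; apply: sm_idem. Qed.

Definition sm_im s : {pred {ffun sm_set s -> O^o}} := fun v => sm_app s v == v.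
Arguments sm_im : clear implicits.

Lemma sm_im_closed s : submod_closed (sm_im s).
Proof.
split=> [|a u v /eqP eu /eqP ev]; apply/eqP.
  by rewrite (lin0 (@sm_app_linear s)).
by rewrite sm_app_linear eu ev.
Qed.
HB.instance Definition _ s := GRing.isSubmodClosed.Build O _ (sm_im s)
  (GRing.submod_closed_semi (@sm_im_closed s)).

Record sm_sort s := SmSort { sm_val : {ffun sm_set s -> O^o}; _ : sm_val \in sm_im s }.
HB.instance Definition _ s := [isSub for @sm_val s].
HB.instance Definition _ s := [Choice of sm_sort s by <:].
HB.instance Definition _ s := [SubChoice_isSubLmodule of sm_sort s by <:].

Lemma sm_valP s (m : sm_sort s) : sm_app s (sm_val m) = sm_val m.
Proof. by case: m => v /= /eqP. Qed.

Lemma sm_mk_subproof s v : sm_app s v \in sm_im s.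
Proof. by apply/eqP; apply: sm_appK. Qed.
Definition sm_mk s v : sm_sort s := SmSort (sm_mk_subproof v).
Arguments sm_mk : clear implicits.

Lemma sm_valK s (m : sm_sort s) : sm_mk s (sm_val m) = m.
Proof. by apply: val_inj; apply: sm_valP. Qed.

Lemma sm_val_lin s : linear (@sm_val s). Proof. by []. Qed.
Lemma sm_mk_lin s : linear (@sm_mk s).
Proof. by move=> a u v; apply: val_inj; rewrite /= sm_app_linear. Qed.

Definition sm_sort_act s (m : sm_sort s) (g : gT) : sm_sort s :=
  if g \in G then sm_mk s (ogm_act (sm_val m : permMod (sm_set s)) g) else m.

Lemma sm_sort_actE s (m : sm_sort s) g : g \in G ->
  sm_val (sm_sort_act m g) = ogm_act (sm_val m : permMod (sm_set s)) g.
Proof.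
move=> Gg; rewrite /sm_sort_act Gg /= /sm_app (mxapp_act (@sm_act s)) //.
by rewrite -/(sm_app s _) sm_valP.
Qed.

Lemma sm_sort_actL s : {in G, forall g, linear ((@sm_sort_act s)^~ g)}.
Proof.
move=> g Gg a u v; apply: val_inj.
by rewrite /= !sm_sort_actE //= perm_actL.
Qed.
Lemma sm_sort_act1 s m : @sm_sort_act s m 1%g = m.
Proof. by apply: val_inj; rewrite /= sm_sort_actE ?group1 // ogm_act1. Qed.
Lemma sm_sort_actM s : {in G &, forall g h m,
  @sm_sort_act s m (g * h)%g = sm_sort_act (sm_sort_act m g) h}.
Proof.
move=> g h Gg Gh m; apply: val_inj.
by rewrite /= !sm_sort_actE ?groupM // ogm_actM.
Qed.
Definition sm_mod s : ogmod := OGMod (@sm_sort_actL s) (@sm_sort_act1 s) (@sm_sort_actM s).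

Section Compl.
Variable s : summand.
Let e := @sm_e s.
Definition co_e (x y : sm_set s) : O := (x == y)%:R - e x y.
Lemma co_eE v : mxapp co_e v = v - sm_app s v.
Proof.
apply/ffunP=> y; rewrite -[in RHS](mxapp_id v) !ffunE /= -sumrB mxapp_id.
by apply: eq_bigr => x _; rewrite mulrBr.
Qed.
Lemma co_idem x z : \sum_y co_e x y * co_e y z = co_e x z.
Proof.
rewrite -[LHS](mxapp_dlt (fun x z => \sum_y co_e x y * co_e y z)) -mxapp_mul.
rewrite -[RHS](mxapp_dlt co_e) !co_eE.
rewrite (linD _ _ (@sm_app_linear s)) (linN _ (@sm_app_linear s)).
by rewrite sm_appK subrr subr0.
Qed.
Lemma co_act : {in G, forall g x y,
  co_e (gset_act (sm_set s) x g) (gset_act (sm_set s) y g) = co_e x y}.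
Proof. by move=> g Gg x y; rewrite /co_e /e sm_act // (inj_eq (act_inj _ g)). Qed.
Definition co_summand := Summand co_idem co_act.

Lemma sm_dsum : ogiso (ogm_dsum (sm_mod s) (sm_mod co_summand)) (permMod (sm_set s)).
Proof.
have eK (m : sm_mod s) : sm_app co_summand (sm_val m) = 0.
  by rewrite [LHS]co_eE sm_valP subrr.
have Ke (m : sm_mod co_summand) : sm_app s (sm_val m) = 0.
  rewrite -[sm_val m]sm_valP [sm_app co_summand _]co_eE.
  rewrite (linD _ _ (@sm_app_linear s)) (linN _ (@sm_app_linear s)).
  by rewrite sm_appK subrr.
apply: (@ogisoI (ogm_dsum (sm_mod s) (sm_mod co_summand)) (permMod (sm_set s))
  (fun u => sm_val u.1 + sm_val u.2) (fun v => (sm_mk s v, sm_mk co_summand v))).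
- by move=> a u v; rewrite /= scalerDr addrACA.
- move=> [m n] /=; congr (_, _); apply: val_inj => /=.
    rewrite (linD _ _ (@sm_app_linear _)) Ke addr0.
    exact: sm_valP.
  rewrite (linD _ _ (@sm_app_linear _)) eK add0r.
  exact: (@sm_valP co_summand n).
- by move=> v /=; rewrite [X in _ + X]co_eE addrC subrK.
- move=> g Gg [m n] /=; rewrite !sm_sort_actE //; apply: esym.
  exact: (linD (f := (@ogm_act (permMod (sm_set s)))^~ g) _ _ (ogm_actL Gg)).
Qed.
End Compl.

Definition sm_row s (x : sm_set s) : sm_mod s := sm_mk s (dlt x).

Lemma sm_row_sum s (m : sm_mod s) : m = \sum_x (sm_val m x : O) *: sm_row x.
Proof.
by rewrite -[LHS]sm_valK {1}[sm_val m]dlt_sum (lin_sum _ _ (@sm_mk_lin s)).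
Qed.

Lemma sm_p_perm s : p_permutation (sm_mod s).
Proof.
split; first by exists (sm_set s), (@sm_row s) => m; exists (sm_val m); apply: sm_row_sum.
by exists (sm_set s), (sm_mod (co_summand s)); apply: sm_dsum.
Qed.

Section TensorSummand.
Variables s t : summand.
Let X := gset_prod (sm_set s) (sm_set t).
Definition tens_e (u v : X) : O := sm_e u.1 v.1 * sm_e u.2 v.2.
Lemma tens_idem u w : \sum_v tens_e u v * tens_e v w = tens_e u w.
Proof.
rewrite /tens_e -(sm_idem u.1) -(sm_idem u.2) big_distrlr pair_big /=.
by apply: eq_bigr => v _; rewrite mulrACA.
Qed.
Lemma tens_act : {in G, forall g u v, tens_e (gset_act X u g) (gset_act X v g) = tens_e u v}.
Proof. by move=> g Gg u v; rewrite /tens_e /= !sm_act. Qed.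
Definition sm_tens := Summand tens_idem tens_act.

Definition tens_val (v : {ffun sm_set s -> O^o}) (w : {ffun sm_set t -> O^o}) :
  {ffun X -> O^o} := [ffun u => (v u.1 : O) * w u.2].

Lemma tens_app v w : sm_app sm_tens (tens_val v w) = tens_val (sm_app s v) (sm_app t w).
Proof.
apply/ffunP=> u; rewrite !ffunE big_distrlr pair_big /=.
by apply: eq_bigr => x _; rewrite !ffunE mulrACA.
Qed.

Definition tens_b (m : sm_mod s) (n : sm_mod t) : sm_mod sm_tens :=
  sm_mk sm_tens (tens_val (sm_val m) (sm_val n)).

Lemma tens_bE m n : sm_val (tens_b m n) = tens_val (sm_val m) (sm_val n).
Proof. by rewrite /= tens_app !sm_valP. Qed.

Lemma sm_tensP : is_tensor (sm_mod s) (sm_mod t) (sm_mod sm_tens).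
Proof.
have bb : bilin tens_b.
  split=> [n|m] a u v; apply: (can_inj (@sm_valK sm_tens));
    rewrite sm_val_lin !tens_bE sm_val_lin; apply/ffunP=> x; rewrite !ffunE.
    by rewrite mulrDl; congr (_ + _); apply: esym (mulrA _ _ _).
  by rewrite mulrDr; congr (_ + _); apply: mulrCA.
have brow x y : tens_b (sm_row x) (sm_row y) = @sm_row sm_tens (x, y).
  apply: val_inj; rewrite [LHS]tens_bE /= -tens_app; congr (sm_app sm_tens _).
  by apply/ffunP=> -[x' y']; rewrite !ffunE /= -natrM mulnb.
exists tens_b; split=> //.
- move=> g Gg m n; apply: val_inj.
  rewrite [LHS]tens_bE [RHS]sm_sort_actE // tens_bE !sm_sort_actE //.
  by apply/ffunP=> u; rewrite !ffunE.
- move=> V beta [bl br].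
  exists (fun z : sm_mod sm_tens => \sum_(u : X) (sm_val z u : O) *: beta (sm_row u.1) (sm_row u.2)); split.
    move=> a z w; rewrite scaler_sumr -big_split; apply: eq_bigr => u _ /=.
    by rewrite !ffunE scalerDl scalerA.
  move=> m n; rewrite tens_bE {2}[m]sm_row_sum {2}[n]sm_row_sum.
  rewrite (lin_sum _ _ (br _)).
  under [RHS]eq_bigr => y _ do rewrite (lin_sum _ _ (bl _)) scaler_sumr.
  rewrite exchange_big pair_big /=; apply: eq_bigr => -[x y] _ /=.
  by rewrite ffunE scalerA mulrC.
- move=> V u u' lu lu' e z; rewrite [z]sm_row_sum !lin_sum //.
  by apply: eq_bigr => -[x y] _; rewrite -brow e.
Qed.
End TensorSummand.

Lemma permMod_iso (X Y : gset G) : gset_iso X Y -> ogiso (permMod X) (permMod Y).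
Proof.
move=> /gset_iso_inv[f [f' [fK f'K fG f'G]]].
apply: (@ogisoI (permMod X) (permMod Y)
  (fun v => [ffun y => v (f' y)]) (fun v => [ffun x => v (f x)])).
- by move=> a u v; apply/ffunP=> x; rewrite !ffunE.
- by move=> v; apply/ffunP=> x; rewrite !ffunE fK.
- by move=> v; apply/ffunP=> x; rewrite !ffunE f'K.
- by move=> g Gg v; apply/ffunP=> y; rewrite !ffunE f'G ?groupV.
Qed.

Lemma p_perm_summand M (X : gset G) (N : ogmod) : ogiso (ogm_dsum M N) (permMod X) ->
  exists s, sm_set s = X /\ ogiso M (sm_mod s).
Proof.
move=> /ogiso_inv[f [f' [[lf lf'] [fK f'K] fG f'G]]].
pose pr (v : permMod X) : permMod X := f ((f' v).1, 0).
have prl : linear pr.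
  move=> a u v; rewrite /pr -lf lf'; congr f.
  by rewrite -pairL.
have prG : {in G, forall g v, pr (ogm_act v g) = ogm_act (pr v) g}.
  move=> g Gg v; rewrite /pr f'G // -fG //; congr (f (_, _)).
  by rewrite /= (lin0 (f := (@ogm_act N)^~ g)) //; apply: ogm_actL.
pose e (x y : X) : O := pr (dlt x) y.
have appE v : mxapp e v = pr v.
  rewrite [in RHS](dlt_sum v) (lin_sum _ _ prl); apply/ffunP=> y.
  by rewrite sum_ffunE ffunE; apply: eq_bigr => x _; rewrite ffunE.
have prK v : pr (pr v) = pr v by rewrite /pr fK.
have e_idem x z : \sum_y e x y * e y z = e x z.
  by rewrite -[LHS](mxapp_dlt (fun x z => \sum_y e x y * e y z)) -mxapp_mul !appE prK.
have e_act : {in G, forall g x y, e (gset_act X x g) (gset_act X y g) = e x y}.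
  move=> g Gg x y; rewrite /e.
  have -> : dlt (gset_act X x g) = ogm_act (dlt x : permMod X) g.
    apply/ffunP=> z; rewrite !ffunE; congr ((nat_of_bool _)%:R).
    apply/eqP/eqP => [<-|->]; last by rewrite -actMin ?groupV // mulVg act1.
    by rewrite -actMin ?groupV // mulgV act1.
  by rewrite prG // ffunE -actMin ?groupV // mulgV act1.
pose s := Summand e_idem e_act.
exists s; split=> //.
have smE v : sm_app s v = pr v by apply: appE.
apply: (@ogisoI M (sm_mod s) (fun m => sm_mk s (f (m, 0))) (fun v => (f' (sm_val v)).1)).
- by move=> a u v; rewrite pairL lf sm_mk_lin.
- by move=> m /=; rewrite smE /pr !fK.
- move=> v; apply: val_inj; rewrite /= smE.
  by rewrite -[RHS]sm_valP smE /pr fK.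
- move=> g Gg m; apply: val_inj; rewrite [RHS]sm_sort_actE //= !smE.
  rewrite -[RHS]prG // -fG //; congr (pr (f (_, _))).
  by rewrite /= (lin0 (f := (@ogm_act N)^~ g)) //; apply: ogm_actL.
Qed.

Lemma p_permP M : p_permutation M <-> exists s, ogiso M (sm_mod s).
Proof.
split=> [[_ [X [N i]]]|[s i]].
  by have [s [_ h]] := p_perm_summand i; exists s.
have /ogiso_inv[f [f' [[lf lf'] [fK f'K] fG f'G]]] := i.
have [[I [e he]] [X [N j]]] := sm_p_perm s; split.
  exists I, (fun k => f' (e k)) => m; have [c hc] := he (f m); exists c.
  by rewrite -(lin_sum _ _ lf') -hc fK.
exists X, N; apply: ogiso_trans j.
apply: (@ogisoI (ogm_dsum M N) (ogm_dsum (sm_mod s) N)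
  (fun u => (f u.1, u.2)) (fun u => (f' u.1, u.2))).
- by move=> a u v; rewrite /= lf.
- by move=> [m n]; rewrite /= fK.
- by move=> [m n]; rewrite /= f'K.
- by move=> g Gg [m n]; rewrite /= /dsum_act /= fG.
Qed.

End Summands.

Section TrivialSource.

Lemma ogm_dsum_iso M M' N N' : ogiso M M' -> ogiso N N' ->
  ogiso (ogm_dsum M N) (ogm_dsum M' N').
Proof.
move=> /ogiso_inv[f [f' [[lf lf'] [fK f'K] fG f'G]]].
move=> /ogiso_inv[h [h' [[lh lh'] [hK h'K] hG h'G]]].
apply: (@ogisoI (ogm_dsum M N) (ogm_dsum M' N')
  (fun u => (f u.1, h u.2)) (fun u => (f' u.1, h' u.2))).
- by move=> a u v; rewrite /= lf lh.
- by move=> [m n]; rewrite /= fK hK.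
- by move=> [m n]; rewrite /= f'K h'K.
- by move=> g Gg [m n]; rewrite /= /dsum_act /= fG // hG.
Qed.

Lemma ogm_dsumA M N L :
  ogiso (ogm_dsum M (ogm_dsum N L)) (ogm_dsum (ogm_dsum M N) L).
Proof.
apply: (@ogisoI (ogm_dsum M (ogm_dsum N L)) (ogm_dsum (ogm_dsum M N) L)
  (fun u => ((u.1, u.2.1), u.2.2)) (fun u => (u.1.1, (u.1.2, u.2)))) => //.
- by move=> [m [n l]].
- by move=> [[m n] l].
Qed.

Lemma ogm_dsumC M N : ogiso (ogm_dsum M N) (ogm_dsum N M).
Proof.
apply: (@ogisoI (ogm_dsum M N) (ogm_dsum N M)
  (fun u => (u.2, u.1)) (fun u => (u.2, u.1))) => //.
- by move=> [m n].
- by move=> [m n].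
Qed.

Lemma permMod_sum (X Y : gset G) :
  ogiso (permMod (gset_sum X Y)) (ogm_dsum (permMod X) (permMod Y)).
Proof.
apply: (@ogisoI (permMod (gset_sum X Y)) (ogm_dsum (permMod X) (permMod Y))
  (fun v => ([ffun x => v (inl x)], [ffun y => v (inr y)]))
  (fun u => [ffun z => match z with inl x => u.1 x | inr y => u.2 y end])).
- move=> a u v; rewrite [RHS]surjective_pairing /=.
  by congr (_, _); apply/ffunP=> x; rewrite !ffunE.
- by move=> v; apply/ffunP=> -[x|y]; rewrite !ffunE.
- by move=> [v w] /=; congr (_, _); apply/ffunP=> x; rewrite !ffunE.
- move=> g Gg v; rewrite /= /dsum_act.
  by congr (_, _); apply/ffunP=> x; rewrite !ffunE.
Qed.

Lemma permMod_prod (X Y : gset G) :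
  is_tensor (permMod X) (permMod Y) (permMod (gset_prod X Y)).
Proof.
pose b (v : permMod X) (w : permMod Y) : permMod (gset_prod X Y) :=
  [ffun u => (v u.1 : O) * w u.2].
have bdlt x y : b (dlt x) (dlt y) = dlt ((x, y) : gset_prod X Y).
  by apply/ffunP=> -[x' y']; rewrite !ffunE /= -natrM mulnb.
exists b; split.
- split=> [n|m] a u v; apply/ffunP=> x; rewrite !ffunE.
    by rewrite mulrDl; congr (_ + _); apply: esym (mulrA _ _ _).
  by rewrite mulrDr; congr (_ + _); apply: mulrCA.
- by move=> g Gg m n; apply/ffunP=> u; rewrite !ffunE.
- move=> V beta [bl br].
  exists (fun z : permMod (gset_prod X Y) =>
    \sum_(u : gset_prod X Y) (z u : O) *: beta (dlt u.1) (dlt u.2)); split.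
    move=> a z w; rewrite scaler_sumr -big_split; apply: eq_bigr => u _ /=.
    by rewrite !ffunE scalerDl scalerA.
  move=> m n; rewrite {2}[m]dlt_sum {2}[n]dlt_sum (lin_sum _ _ (br _)).
  under [RHS]eq_bigr => y _ do rewrite (lin_sum _ _ (bl _)) scaler_sumr.
  rewrite exchange_big pair_big /=; apply: eq_bigr => -[x y] _ /=.
  by rewrite ffunE scalerA mulrC.
- move=> V u u' lu lu' e z; rewrite [z]dlt_sum !lin_sum //.
  by apply: eq_bigr => -[x y] _; rewrite -bdlt e.
Qed.

Lemma p_perm_permMod (X : gset G) : p_permutation (permMod X).
Proof.
split; first by exists X, (@dlt X) => m; exists m; apply: dlt_sum.
exists X, (permMod (gset_triv G void)); apply: ogiso_trans (ogm_dsumC _ _) _.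
apply: ogiso_trans (ogiso_sym (permMod_sum _ _)) _.
exact/permMod_iso/gset_sum0.
Qed.
Definition pp_perm (X : gset G) : pperm := PPerm (p_perm_permMod X).

Lemma p_perm_dsum M N : p_permutation M -> p_permutation N ->
  p_permutation (ogm_dsum M N).
Proof.
move=> [[I [e he]] [X [M' iM]]] [[J [f hf]] [Y [N' iN]]]; split.
  exists (I + J)%type, (fun k => match k with inl i => (e i, 0) | inr j => (0, f j) end).
  move=> [m n]; have [c hc] := he m; have [d hd] := hf n.
  exists (fun k => match k with inl i => c i | inr j => d j end).
  rewrite big_sumType /= pairLR {1}hc {1}hd; congr (_ + _).
    apply: (lin_sum (f := fun m => (m, 0) : M * N)) => a u v; exact: pairL.
  by apply: (lin_sum (f := fun n => (0, n) : M * N)) => a u v; exact: pairR.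
exists (gset_sum X Y), (ogm_dsum M' N').
apply: ogiso_trans (ogiso_sym (permMod_sum _ _)).
apply: ogiso_trans (ogm_dsum_iso iM iN).
apply: (@ogisoI (ogm_dsum (ogm_dsum M N) (ogm_dsum M' N'))
   (ogm_dsum (ogm_dsum M M') (ogm_dsum N N'))
  (fun u => ((u.1.1, u.2.1), (u.1.2, u.2.2)))
  (fun u => ((u.1.1, u.2.1), (u.1.2, u.2.2)))) => //.
- by move=> [[m n] [m' n']].
- by move=> [[m n] [m' n']].
Qed.
Definition pp_sum (M N : pperm) : pperm := PPerm (p_perm_dsum (pp_modP M) (pp_modP N)).

Lemma pp_tens_ex (M N : pperm) : exists L : pperm, is_tensor M N L.
Proof.
have [s iM] := (p_permP M).1 (pp_modP M).
have [t iN] := (p_permP N).1 (pp_modP N).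
exists (PPerm (sm_p_perm (sm_tens s t))).
exact: tensor_transp (ogiso_sym iM) (ogiso_sym iN) (sm_tensP s t).
Qed.
(** Some p-permutation module which is a tensor product of [M] and [N]. *)
Definition pp_tens (M N : pperm) : pperm := projT1 (cid (pp_tens_ex M N)).
Lemma pp_tensP (M N : pperm) : is_tensor M N (pp_tens M N).
Proof. by rewrite /pp_tens; case: cid. Qed.

(** Small representatives of the p-permutation modules: images of equivariant
    idempotent matrices over G-sets of the form 'I_n. *)
Record pp_sk : Type := PPSk {
  ps_set : gset_sk G;
  ps_e : 'I_(projT1 ps_set) -> 'I_(projT1 ps_set) -> O;
  ps_idem : forall x z, \sum_y ps_e x y * ps_e y z = ps_e x z;
  ps_act : {in G, forall g x y, ps_e (projT2 ps_set x g) (projT2 ps_set y g) = ps_e x y} }.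

Definition pp_emb (s : pp_sk) : pperm :=
  PPerm (sm_p_perm (@Summand (gset_emb (ps_set s)) (@ps_e s) (@ps_idem s) (@ps_act s))).

Definition pp_iso (M N : pperm) := ogiso M N.

Lemma pp_dense (M : pperm) : exists s, pp_iso M (pp_emb s).
Proof.
have [_ [X [N i]]] := pp_modP M.
have j := ogiso_trans i (permMod_iso (gset_smallP X)).
have [[X' e e_idem e_act] [/= eX k]] := p_perm_summand j; subst X'.
by exists (@PPSk (gset_small X) e e_idem e_act).
Qed.

Lemma pp_iso_refl (M : pperm) : pp_iso M M. Proof. exact: ogiso_refl. Qed.
Lemma pp_iso_sym (M N : pperm) : pp_iso M N -> pp_iso N M.
Proof. exact: ogiso_sym. Qed.
Lemma pp_iso_trans (M N L : pperm) : pp_iso M N -> pp_iso N L -> pp_iso M L.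
Proof. exact: ogiso_trans. Qed.
Lemma pp_sum_iso (M M' N N' : pperm) : pp_iso M M' -> pp_iso N N' ->
  pp_iso (pp_sum M N) (pp_sum M' N').
Proof. exact: ogm_dsum_iso. Qed.
Lemma pp_tens_iso (M M' N N' : pperm) : pp_iso M M' -> pp_iso N N' ->
  pp_iso (pp_tens M N) (pp_tens M' N').
Proof.
move=> iM iN; apply: tensor_uniq (pp_tensP M' N').
exact: tensor_transp iM iN (pp_tensP M N).
Qed.
Lemma pp_sumA (M N L : pperm) : pp_iso (pp_sum M (pp_sum N L)) (pp_sum (pp_sum M N) L).
Proof. exact: ogm_dsumA. Qed.
Lemma pp_sumC (M N : pperm) : pp_iso (pp_sum M N) (pp_sum N M).
Proof. exact: ogm_dsumC. Qed.
Definition pp_zero : pperm := pp_perm (gset_triv G void).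
Definition pp_one : pperm := pp_perm (gset_triv G unit).
Lemma pp_sum0 (M : pperm) : pp_iso (pp_sum pp_zero M) M.
Proof.
apply: (@ogisoI (pp_sum pp_zero M) M snd (fun m => (0, m))) => //.
by move=> [v m]; rewrite /= (permMod_void v 0).
Qed.
Lemma pp_tensA (M N L : pperm) :
  pp_iso (pp_tens M (pp_tens N L)) (pp_tens (pp_tens M N) L).
Proof.
apply: tensor_uniq (pp_tensP _ _) _.
exact: tensorA (pp_tensP _ _) (pp_tensP _ _) (pp_tensP _ _).
Qed.
Lemma pp_tensC (M N : pperm) : pp_iso (pp_tens M N) (pp_tens N M).
Proof. by apply: tensor_uniq (pp_tensP _ _) _; apply/tensorC/pp_tensP. Qed.
Lemma pp_tens1 (M : pperm) : pp_iso (pp_tens pp_one M) M.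
Proof. by apply: tensor_uniq (pp_tensP _ _) _; apply: tensor1. Qed.
Lemma pp_tensDl (M N L : pperm) :
  pp_iso (pp_tens (pp_sum M N) L) (pp_sum (pp_tens M L) (pp_tens N L)).
Proof. by apply: tensor_uniq (pp_tensP _ _) _; apply: tensorDl; apply: pp_tensP. Qed.
Lemma pp_tens0 (M : pperm) : pp_iso (pp_tens pp_zero M) pp_zero.
Proof. by apply: tensor_uniq (pp_tensP _ _) _; apply: tensor0. Qed.

Definition pperm_rig : rig_cat :=
  RigCat pp_dense pp_iso_refl pp_iso_sym pp_iso_trans pp_sum_iso pp_tens_iso
    pp_sumA pp_sumC pp_sum0 pp_tensA pp_tensC pp_tens1 pp_tensDl pp_tens0.

Definition trivial_source : comPzRingType := groth_ring pperm_rig.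

Definition lam_cls (X : gset_rig G) : trivial_source := @gcls pperm_rig (pp_perm X).

Lemma lam_iso (X Y : gset_rig G) : rc_iso X Y -> lam_cls X = lam_cls Y.
Proof. by move=> i; apply: gcls_iso; apply: permMod_iso. Qed.
Lemma lam0 : lam_cls (rc_zero (gset_rig G)) = 0.
Proof. by rewrite -gcls0. Qed.
Lemma lam1 : lam_cls (rc_one (gset_rig G)) = 1.
Proof. by rewrite -gcls1. Qed.
Lemma lamD (X Y : gset_rig G) : lam_cls (rc_sum X Y) = lam_cls X + lam_cls Y.
Proof. by rewrite -gclsD; apply: gcls_iso; apply: permMod_sum. Qed.
Lemma lamM (X Y : gset_rig G) : lam_cls (rc_prod X Y) = lam_cls X * lam_cls Y.
Proof.
rewrite -gclsM; apply: gcls_iso.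
exact: (tensor_uniq (permMod_prod X Y) (pp_tensP (pp_perm X) (pp_perm Y))).
Qed.

Definition lam : {rmorphism burnside G -> trivial_source} :=
  groth_ext (RigInv lam_iso lam0 lamD lam1 lamM).

Lemma lamE (X : gset G) : lam (@gcls (gset_rig G) X) = @gcls pperm_rig (pp_perm X).
Proof. exact: groth_extE. Qed.

End TrivialSource.

End Modules.

Section ResTrivialSource.
Variables (O : comPzRingType) (gT : finGroupType) (G H : {group gT}).
Hypothesis sHG : H \subset G.
Implicit Types M N L : ogmod O G.

Section Mod.
Variable M : ogmod O G.
Lemma ogm_res_actL : {in H, forall g, linear ((@ogm_act _ _ _ M)^~ g)}.
Proof. by move=> g Hg; apply/ogm_actL/(fintype.subsetP sHG). Qed.
Lemma ogm_res_actM : {in H &, forall g h m,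
  @ogm_act _ _ _ M m (g * h)%g = ogm_act (ogm_act m g) h}.
Proof. by move=> g h Hg Hh; apply: ogm_actM; apply: (fintype.subsetP sHG). Qed.
Definition ogm_res : ogmod O H := OGMod ogm_res_actL (@ogm_act1 _ _ _ M) ogm_res_actM.
End Mod.

Lemma ogm_res_iso M N : ogiso M N -> ogiso (ogm_res M) (ogm_res N).
Proof.
move=> [f [lf bf fG]]; exists f; split=> // g Hg.
by apply: fG; apply: (fintype.subsetP sHG).
Qed.

Lemma ogm_res_dsum M N :
  ogiso (ogm_res (ogm_dsum M N)) (ogm_dsum (ogm_res M) (ogm_res N)).
Proof. by exists id; split=> //; exists id. Qed.

Lemma ogm_res_perm (X : gset G) :
  ogiso (ogm_res (permMod O X)) (permMod O (gset_res sHG X)).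
Proof. by exists id; split=> //; exists id. Qed.

Lemma ogm_res_tensor M N L :
  is_tensor M N L -> is_tensor (ogm_res M) (ogm_res N) (ogm_res L).
Proof.
move=> [b [bb bG bu bun]]; exists b; split=> // g Hg.
by apply: bG; apply: (fintype.subsetP sHG).
Qed.

Lemma ogm_res_pperm M : p_permutation M -> p_permutation (ogm_res M).
Proof.
move=> [fgM [X [N i]]]; split=> //; exists (gset_res sHG X), (ogm_res N).
apply: ogiso_trans (ogiso_sym (ogm_res_dsum _ _)) _.
exact: ogiso_trans (ogm_res_iso i) (ogm_res_perm X).
Qed.
Definition pp_res (M : pperm O G) : pperm O H := PPerm (ogm_res_pperm (pp_modP M)).

Definition res_ts_cls (M : pperm_rig O G) : trivial_source O H :=
  @gcls (pperm_rig O H) (pp_res M).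

Lemma res_ts_iso (M N : pperm_rig O G) : rc_iso M N -> res_ts_cls M = res_ts_cls N.
Proof. by move=> i; apply: gcls_iso; apply: ogm_res_iso. Qed.
Lemma res_ts0 : res_ts_cls (rc_zero (pperm_rig O G)) = 0.
Proof. by rewrite -gcls0; apply: gcls_iso; exists id; split=> //; exists id. Qed.
Lemma res_ts1 : res_ts_cls (rc_one (pperm_rig O G)) = 1.
Proof. by rewrite -gcls1; apply: gcls_iso; exists id; split=> //; exists id. Qed.
Lemma res_tsD (M N : pperm_rig O G) : res_ts_cls (rc_sum M N) = res_ts_cls M + res_ts_cls N.
Proof. by rewrite -gclsD; apply: gcls_iso; apply: ogm_res_dsum. Qed.
Lemma res_tsM (M N : pperm_rig O G) : res_ts_cls (rc_prod M N) = res_ts_cls M * res_ts_cls N.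
Proof.
rewrite -gclsM; apply: gcls_iso.
exact: (tensor_uniq (ogm_res_tensor (pp_tensP M N)) (pp_tensP (pp_res M) (pp_res N))).
Qed.

Definition trivial_source_res : {rmorphism trivial_source O G -> trivial_source O H} :=
  groth_ext (RigInv res_ts_iso res_ts0 res_tsD res_ts1 res_tsM).

Lemma trivial_source_resE (M : pperm O G) :
  trivial_source_res (@gcls (pperm_rig O G) M) = @gcls (pperm_rig O H) (pp_res M).
Proof. exact: groth_extE. Qed.

End ResTrivialSource.

Section BurnsideFusion.
Variables (gT : finGroupType) (G S : {group gT}).

(** The elements of B(F), where F is the fusion system of [G] on [S], are those
    taking the same mark at any two subgroups of [S] conjugate in [G]. *)
Definition fusion_stable : {pred burnside S} := fun a =>
  `[< forall P Q : {group gT}, P \subset S -> Q \subset S ->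
      (exists2 g, g \in G & Q = (P :^ g)%G) -> mark S P a = mark S Q a >].

Lemma fusion_stable_closed : subring_closed fusion_stable.
Proof.
split; first by apply/asboolP => P Q _ _ _; rewrite !rmorph1.
  move=> a b /asboolP ha /asboolP hb; apply/asboolP => P Q sP sQ c.
  by rewrite !rmorphB /= (ha P Q) // (hb P Q).
move=> a b /asboolP ha /asboolP hb; apply/asboolP => P Q sP sQ c.
by rewrite !rmorphM /= (ha P Q) // (hb P Q).
Qed.
HB.instance Definition _ :=
  GRing.isSubringClosed.Build (burnside S) fusion_stable fusion_stable_closed.

Record burnside_fusion := BurnsideFusion {
  bf_val :> burnside S; _ : bf_val \in fusion_stable }.
HB.instance Definition _ := [isSub for bf_val].
HB.instance Definition _ := [Choice of burnside_fusion by <:].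
HB.instance Definition _ :=
  GRing.SubChoice_isSubComPzRing.Build _ _ burnside_fusion (subringClosedP _).

Hypothesis sSG : S \subset G.

Lemma card_fix_conj (X : gset G) (P : {group gT}) g : P \subset G -> g \in G ->
  #|('Fix_(gset_act X)(P :^ g))%g| = #|('Fix_(gset_act X)(P))%g|.
Proof.
move=> sPG Gg; rewrite -[RHS](card_imset _ (act_inj (gset_act X) g)).
have inG := fintype.subsetP sPG; apply: eq_card => y; apply/afixP/imsetP.
  move=> hy; exists (gset_act X y g^-1%g).
    apply/afixP => q Pq; have Gq := inG q Pq.
    have := hy (q ^ g)%g; rewrite memJ_conjg => /(_ Pq) e.
    rewrite -actMin ?groupV // -[in RHS]e -actMin ?groupV ?groupJ //.
    by congr (gset_act X y _); rewrite conjgE mulgA mulgK.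
  by rewrite -actMin ?groupV // mulVg act1.
move=> [x /afixP hx ->] q Pq.
have Pq' : (q ^ g^-1)%g \in P by rewrite -mem_conjg.
have Gq' := inG _ Pq'.
have Gqg : ((q ^ g^-1) ^ g)%g \in G by rewrite groupJ.
rewrite -(conjgKV g q) -(actMin _ _ Gg Gqg) -conjgC (actMin _ _ Gq' Gg).
by rewrite hx.
Qed.

Lemma burnside_res_stable (x : burnside G) : burnside_res sSG x \in fusion_stable.
Proof.
suff H (X : gset G) : burnside_res sSG (@gcls (gset_rig G) X) \in fusion_stable.
  by have [X [Y ->]] := gclsBE x; rewrite rmorphB; apply: rpredB; apply: H.
rewrite burnside_resE; apply/asboolP => P Q sPS sQS [g Gg eQ].
rewrite !markE //= eQ; congr (_%:R); apply/esym/card_fix_conj => //.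
exact: fintype.subset_trans sPS sSG.
Qed.

Definition burnside_resF_fun (x : burnside G) : burnside_fusion :=
  BurnsideFusion (burnside_res_stable x).

Lemma burnside_resF_zmod : zmod_morphism burnside_resF_fun.
Proof. by move=> x y; apply: val_inj; exact: (rmorphB (burnside_res sSG)). Qed.
Lemma burnside_resF_mon : monoid_morphism burnside_resF_fun.
Proof.
split=> [|x y]; apply: val_inj; first exact: (rmorph1 (burnside_res sSG)).
exact: (rmorphM (burnside_res sSG)).
Qed.
HB.instance Definition _ := GRing.isZmodMorphism.Build (burnside G) burnside_fusion
  burnside_resF_fun burnside_resF_zmod.
HB.instance Definition _ := GRing.isMonoidMorphism.Build (burnside G) burnside_fusion
  burnside_resF_fun burnside_resF_mon.
Definition burnside_resF : {rmorphism burnside G -> burnside_fusion} := burnside_resF_fun.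

End BurnsideFusion.

Section PModularSystem.
Variables (K : fieldType) (O : idomainType) (F : fieldType).

(** A discrete valuation; [v 0], which would be +oo, is irrelevant. *)
Record discrete_valuation (v : K -> int) : Prop := {
  dv_mul : forall x y, x != 0 -> y != 0 -> v (x * y) = v x + v y;
  dv_add : forall x y, x != 0 -> y != 0 -> x + y != 0 ->
    Num.min (v x) (v y) <= v (x + y);
  dv_surj : forall n, exists2 x, x != 0 & v x = n }.

Definition val_ge (v : K -> int) (n : int) (x : K) := x = 0 \/ n <= v x.

(** Cauchy sequences converge for the topology defined by the valuation. *)
Definition val_complete (v : K -> int) (iota : O -> K) :=
  forall u : nat -> O,
    (forall n, exists i0, forall i j, (i0 <= i)%N -> (i0 <= j)%N ->
       val_ge v n (iota (u i - u j))) ->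
    exists l, forall n, exists i0, forall i, (i0 <= i)%N ->
      val_ge v n (iota (u i - l)).

(** (K, O, F), with the embedding [iota] of O in its field of fractions K and
    the reduction [red] of O onto its residue field F. *)
Record p_modular_system (p : nat)
    (iota : {rmorphism O -> K}) (red : {rmorphism O -> F}) : Prop := {
  pms_inj : injective iota;
  pms_frac : forall x : K, exists a b : O, b != 0 /\ x = iota a / iota b;
  pms_val : exists v : K -> int,
    [/\ discrete_valuation v,
        forall x : K, (exists a, x = iota a) <-> val_ge v 0 x,
        forall a : O, red a = 0 <-> val_ge v 1 (iota a) &
        val_complete v iota];
  pms_surj : forall y : F, exists a, y = red a;
  pms_charK : [pchar K] =i pred0;
  pms_charF : p \in [pchar F] }.

End PModularSystem.

Section Decomposition.
Local Open Scope classical_set_scope.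
Variable R : comPzRingType.

Definition is_ideal (I : set R) :=
  [/\ I 0, forall x y, I x -> I y -> I (x + y) & forall a x, I x -> I (a * x)].

Definition is_subring (A : set R) :=
  [/\ A 1, forall x y, A x -> A y -> A (x - y) & forall x y, A x -> A y -> A (x * y)].

Definition subring_iso (Q : comPzRingType) (A : set R) :=
  exists f : {rmorphism Q -> R}, injective f /\ range f = A.

(** R is the direct sum of its ideal [I] and of its subring [A], which is
    isomorphic to [Q]. *)
Definition ideal_subring_decomposition (Q : comPzRingType) (I A : set R) :=
  [/\ is_ideal I, is_subring A, subring_iso Q A &
      forall x, exists! u : R * R, [/\ I u.1, A u.2 & x = u.1 + u.2]].

Definition ring_ker (Q : comPzRingType) (f : R -> Q) : set R := [set x | f x = 0].
End Decomposition.

(* Main.v *)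
Require Import Defs.
From mathcomp Require Import boolp classical_sets.
From HB Require Import structures.
From mathcomp Require Import all_boot all_order all_algebra all_fingroup all_solvable.
From mathcomp Require Import mxrepresentation mxabelem.

(** An element of B(G) is determined by its marks, and the families of marks are
    cut out by congruences. Given a in B(F), put at each subgroup H of G the mark
    of a at a Sylow p-subgroup of H, moved into S by conjugation. The congruences
    of this family at a prime other than p hold since the summands are equal, and
    those at p are congruences of a in B(S); so it is the family of marks of an
    element t(a), and t is a ring homomorphism because marks are.

    That lambda_S is injective follows by reducing equivariant matrices modulo the
    maximal ideal of O and restricting them to fixed points: for a p-group, the
    other orbits contribute 0 to products. The same computation, applied to the
    action of an element of G, gives the stability of restrictions to S. That
    lambda_S is surjective is the theorem of Krull and Schmidt: an endomorphism of
    O[S/Q] is invertible as soon as its column sum is, because a p-group has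
    nonzero fixed vectors in characteristic p. The second composition is then the
    first one, as restriction commutes with lambda. *)

Set Implicit Arguments.
Unset Strict Implicit.
Unset Printing Implicit Defensive.
Import Order.TTheory GRing.Theory Num.Theory.

(** * Inverses of bijective ring homomorphisms, and decompositions from sections *)

Section Rings.
Local Open Scope ring_scope.

Lemma bij_rmorphism (A B : comPzRingType) (f : {rmorphism A -> B}) :
  injective f -> (forall b, exists a, f a = b) ->
  exists g : {rmorphism B -> A}, cancel f g /\ cancel g f.
Proof.
move=> f_inj f_surj; pose g b := projT1 (cid (f_surj b)).
have gK : cancel g f by rewrite /g => b; case: cid.
have fK : cancel f g by move=> a; apply: f_inj; rewrite gK.
have gB : zmod_morphism g by move=> x y; apply: f_inj; rewrite rmorphB !gK.
have gM : monoid_morphism g.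
  by split=> [|x y]; apply: f_inj; rewrite ?rmorph1 ?rmorphM !gK.
pose gB_mix := GRing.isZmodMorphism.Build B A g gB.
pose gM_mix := GRing.isMonoidMorphism.Build B A g gM.
by exists (HB.pack_for {rmorphism B -> A} g gB_mix gM_mix).
Qed.

(** The component of [x] in the range of [t] is [t q], where [v q = f x]. Here [v] will be the
    inclusion of B(F) in B(S), so that [f] may keep its values in B(S). *)
Lemma section_decomposition (R Q Q' : comPzRingType) (f : {rmorphism R -> Q'})
    (t : {rmorphism Q -> R}) (v : {rmorphism Q -> Q'}) :
  injective v -> (forall q, f (t q) = v q) -> (forall x, exists q, f x = v q) ->
  ideal_subring_decomposition Q (ring_ker f) (range t).
Proof.
move=> v_inj ftv fv; split.
- split=> [|x y|a x]; rewrite /ring_ker /=; first by rewrite rmorph0.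
    by move=> fx fy; rewrite rmorphD fx fy addr0.
  by move=> fx; rewrite rmorphM fx mulr0.
- split=> [|_ _ [x _ <-] [y _ <-]|_ _ [x _ <-] [y _ <-]].
  + by exists 1; rewrite ?rmorph1.
  + by exists (x - y); rewrite ?rmorphB.
  + by exists (x * y); rewrite ?rmorphM.
- exists t; split=> // x y e; apply: v_inj.
  by rewrite -!ftv e.
move=> x; have [q fxq] := fv x; exists (x - t q, t q); split=> /=.
  split; last by rewrite subrK.
    by rewrite /ring_ker /= rmorphB ftv fxq subrr.
  by exists q.
move=> [y _] [/= fy [r _ <-]] ex.
have -> : q = r by apply: v_inj; rewrite -fxq ex rmorphD fy add0r ftv.
by rewrite ex addrK.
Qed.

(** The form needed for T(OG), where both the retraction and the section are composites. *)
Lemma section_decomposition_comp (R R' Q Q' B : comPzRingType)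
    (f : {rmorphism R -> R'}) (h : {rmorphism R' -> Q'})
    (t : {rmorphism Q -> B}) (l : {rmorphism B -> R}) (v : {rmorphism Q -> Q'}) :
  injective v -> (forall q, h (f (l (t q))) = v q) ->
  (forall x, exists q, h (f x) = v q) ->
  ideal_subring_decomposition Q (ring_ker (h \o f)) (range (l \o t)).
Proof. exact: (@section_decomposition _ _ _ (h \o f) (l \o t)). Qed.

End Rings.

(** * Sub-G-sets, orbits, and recovering a G-set from its fixed points *)

Section SubGsets.
Variables (gT : finGroupType) (G : {group gT}).
Implicit Types X Y : gset G.
Local Open Scope group_scope.

(** Choice turns a bijective equivariant relation into a pair of inverse maps, which avoids formulas
    for maps between subtypes or orbits. *)
Lemma gset_iso_rel X Y (r : X -> Y -> Prop) :
    (forall x, exists y, r x y) -> (forall y, exists x, r x y) ->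
    (forall x y y', r x y -> r x y' -> y = y') ->
    (forall x x' y, r x y -> r x' y -> x = x') ->
    {in G, forall g x y, r x y -> r (gset_act X x g) (gset_act Y y g)} ->
  gset_iso X Y.
Proof.
move=> rX rY r_fun r_inj rG.
pose f x := projT1 (cid (rX x)); pose f' y := projT1 (cid (rY y)).
have fP x : r x (f x) by rewrite /f; case: cid.
have f'P y : r (f' y) y by rewrite /f'; case: cid.
apply: (@gset_isoI _ _ X Y f f') => [x|y|g Gg x].
- exact: r_inj (f'P _) (fP x).
- exact: r_fun (fP _) (f'P y).
- exact: r_fun (fP _) (rG g Gg _ _ (fP x)).
Qed.

Section Sub.
Variables (X : gset G) (A : {set X}).
Hypothesis actsA : [acts G, on A | gset_act X].

Lemma gset_sub_dom : G \subset subact_dom (mem A) (gset_act X).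
Proof.
apply: fintype.subset_trans actsA _; rewrite /subact_dom.
by have -> : [set x | mem A x] = A by apply/setP=> x; rewrite inE.
Qed.

Definition gset_sub : gset G :=
  @GSet gT G {x | x \in A} ((gset_act X)^? \ gset_sub_dom)%act.

Lemma val_gset_sub : {in G, forall g (u : gset_sub),
  val (gset_act gset_sub u g) = gset_act X (val u) g}.
Proof.
by move=> g Gg u; rewrite /= val_subact (fintype.subsetP gset_sub_dom).
Qed.

Lemma card_fix_gset_sub (P : {group gT}) : P \subset G ->
  #|'Fix_(gset_act gset_sub)(P)| = #|A :&: 'Fix_(gset_act X)(P)|.
Proof.
move=> /fintype.subsetP sPG; rewrite -(card_imset _ val_inj).
apply: eq_card => x; apply/imsetP/setIP => [[u /afixP uP ->]|[Ax /afixP xP]].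
  split; first exact: valP.
  by apply/afixP => g Pg; rewrite -val_gset_sub ?sPG // uP.
exists (exist _ x Ax) => //; apply/afixP => g Pg; apply: val_inj.
by rewrite val_gset_sub ?sPG //= xP.
Qed.
End Sub.

Lemma gset_split X (A : {set X}) (actsA : [acts G, on A | gset_act X])
    (actsC : [acts G, on ~: A | gset_act X]) :
  gset_iso X (gset_sum (gset_sub actsA) (gset_sub actsC)).
Proof.
apply: gset_iso_sym.
apply: (@gset_iso_rel (gset_sum (gset_sub actsA) (gset_sub actsC)) X
  (fun u x => match u with inl y => val y = x | inr y => val y = x end)).
- by case=> y; eexists.
- move=> x; case: (boolP (x \in A)) => Ax.
    by exists (inl (exist _ x Ax)).
  have Cx : x \in ~: A by rewrite inE.
  by exists (inr (exist _ x Cx)).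
- by case=> y x x' <- <-.
- case=> [[y Ay]|[y Ay]] [[z Az]|[z Az]] x /= e e'; subst x z.
  + by rewrite (bool_irrelevance Ay Az).
  + by have := Az; rewrite inE Ay.
  + by have := Ay; rewrite inE Az.
  + by rewrite (bool_irrelevance Ay Az).
- by move=> g Gg [y|y] x <-; apply: val_gset_sub.
Qed.

Definition gset_orbit X (x : X) : gset G :=
  gset_sub (acts_orbit (gset_act X) x (fintype.subxx _)).

Definition gset_rest X (x : X) : gset G :=
  gset_sub (A := ~: orbit (gset_act X) G x)
    (etrans (congr1 (fun N : {set gT} => G \subset N) (astabsC _ _))
       (acts_orbit (gset_act X) x (fintype.subxx _))).

Lemma gset_orbit_split X (x : X) : gset_iso X (gset_sum (gset_orbit x) (gset_rest x)).
Proof. exact: gset_split. Qed.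

Lemma card_gset_rest X (x : X) : #|gset_rest x| < #|X|.
Proof.
rewrite card_sig -cardsT; apply/proper_card/properP; split.
  by apply/fintype.subsetP => y _; rewrite inE.
by exists x; rewrite !inE ?orbit_refl.
Qed.

(** The relation pairing [x g] with [y g] is a bijection, since [x g = x h] exactly when [g h^-1]
    lies in the common stabilizer. *)
Lemma gset_orbit_iso X Y (x : X) (y : Y) :
  'C_G[x | gset_act X] = 'C_G[y | gset_act Y] ->
  gset_iso (gset_orbit x) (gset_orbit y).
Proof.
move=> eC.
have stabE g : g \in G -> (gset_act X x g == x) = (gset_act Y y g == y).
  move=> Gg; have := congr1 (fun C : {set gT} => g \in C) eC.
  by rewrite !inE Gg /= !sub1set !inE.
have keyE g h : g \in G -> h \in G ->
    (gset_act X x g == gset_act X x h) = (gset_act Y y g == gset_act Y y h).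
  move=> Gg Gh; rewrite -(inj_eq (act_inj (gset_act X) h^-1)).
  rewrite -(inj_eq (act_inj (gset_act Y) h^-1)).
  by rewrite -!actMin ?groupV // mulgV !act1 stabE // groupM ?groupV.
apply: (@gset_iso_rel (gset_orbit x) (gset_orbit y) (fun u v => exists2 g, g \in G &
  val u = gset_act X x g /\ val v = gset_act Y y g)).
- move=> [u ux]; have /orbitP[g Gg e] := ux.
  by exists (exist (fun z => z \in orbit _ G _) _ (mem_orbit (gset_act Y) y Gg)), g.
- move=> [v vy]; have /orbitP[g Gg e] := vy.
  by exists (exist (fun z => z \in orbit _ G _) _ (mem_orbit (gset_act X) x Gg)), g.
- move=> u v v' [g Gg [eu ev]] [h Gh [eu' ev']]; apply: val_inj.
  by apply/eqP; rewrite ev ev' -keyE // -eu -eu'.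
- move=> u u' v [g Gg [eu ev]] [h Gh [eu' ev']]; apply: val_inj.
  by apply/eqP; rewrite eu eu' keyE // -ev -ev'.
- move=> g Gg u v [h Gh [eu ev]]; exists (h * g); first exact: groupM.
  by rewrite !val_gset_sub // eu ev !actMin.
Qed.

Lemma card_fix_iso X Y (P : {group gT}) : P \subset G -> gset_iso X Y ->
  #|'Fix_(gset_act X)(P)| = #|'Fix_(gset_act Y)(P)|.
Proof.
move=> sPG /mark_iso e; have := e P; rewrite /mark_fun /fixpts (setIidPr sPG).
by move=> /eqP; rewrite eqr_nat => /eqP.
Qed.

Lemma card_fix_sum X Y (P : {group gT}) : P \subset G ->
  #|'Fix_(gset_act (gset_sum X Y))(P)| =
    (#|'Fix_(gset_act X)(P)| + #|'Fix_(gset_act Y)(P)|)%N.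
Proof.
move=> sPG; have := markD P X Y; rewrite /mark_fun /fixpts (setIidPr sPG).
by rewrite -natrD => /eqP; rewrite eqr_nat => /eqP.
Qed.

(* A point of X whose stabilizer has maximal order has the same stabilizer as
   some point of Y, so that isomorphic orbits can be removed from X and Y. *)
Lemma gset_iso_fix X Y :
    (forall P : {group gT}, P \subset G ->
       #|'Fix_(gset_act X)(P)| = #|'Fix_(gset_act Y)(P)|) ->
  gset_iso X Y.
Proof.
have [n] := ubnP #|X|; elim: n X Y => // n IHn X Y leXn fixE.
case: (pickP X) => [x0 _|X0]; last first.
  have cX : #|X| = 0 by apply: eq_card0.
  have cY : #|Y| = 0.
    have := fixE 1%G (sub1G G); rewrite !afix1 // !cardsT cX => /esym //.
  apply: (@gset_iso_rel X Y (fun _ _ => False)) => // z.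
    by have := X0 z.
  by have := fintype0 z cY.
have stab_fix (Z : gset G) (z : Z) (P : {group gT}) : P \subset G ->
    (z \in 'Fix_(gset_act Z)(P)) = (P \subset 'C_G[z | gset_act Z]).
  by move=> sPG; rewrite subsetI sPG sub_astab1_in.
(* Take for [P] the stabilizer of [z]: it fixes [z], hence also some point of [Z']. *)
have fixN0 (Z Z' : gset G) (z : Z) :
    (forall P : {group gT}, P \subset G ->
       #|'Fix_(gset_act Z)(P)| = #|'Fix_(gset_act Z')(P)|) ->
    exists z' : Z', 'C_G[z | gset_act Z] \subset 'C_G[z' | gset_act Z'].
  move=> fixZ; have sCG := subsetIl G 'C[z | gset_act Z].
  have /card_gt0P[z'] : 0 < #|'Fix_(gset_act Z')('C_G[z | gset_act Z])|.
    rewrite -(fixZ 'C_G[z | gset_act Z]%G) //; apply/card_gt0P; exists z.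
    by rewrite (stab_fix _ _ 'C_G[z | gset_act Z]%G).
  by rewrite (stab_fix _ _ 'C_G[z | gset_act Z]%G) // => ?; exists z'.
pose x := [arg max_(x > x0) #|'C_G[x | gset_act X]|].
have x_max z : #|'C_G[z | gset_act X]| <= #|'C_G[x | gset_act X]|.
  by rewrite /x; case: arg_maxnP => // i _; apply.
have [y sxy] := fixN0 _ _ x fixE.
(* Returning to [X] gives a chain of stabilizers of [x], [y], [z]; maximality of the first forces
   the first two to coincide. *)
have [z syz] := fixN0 _ _ y (fun P sP => esym (fixE P sP)).
have eC : 'C_G[x | gset_act X] = 'C_G[y | gset_act Y].
  apply/eqP; rewrite eqEcard sxy; exact: leq_trans (subset_leq_card syz) (x_max z).
have iO := gset_orbit_iso eC.
have iX := gset_orbit_split x; have iY := gset_orbit_split y.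
apply: (gset_iso_trans iX); apply: (gset_iso_trans _ (gset_iso_sym iY)).
apply: gset_sum_iso => //; apply: IHn.
  exact: leq_trans (card_gset_rest x) leXn.
move=> P sPG; have := fixE P sPG.
rewrite (card_fix_iso sPG iX) (card_fix_iso sPG iY) !card_fix_sum //.
by rewrite (card_fix_iso sPG iO) => /addnI.
Qed.
End SubGsets.

(** * Injectivity of the marks on the Burnside ring *)

Section Marks.
Variables (gT : finGroupType) (G : {group gT}).
Local Open Scope ring_scope.

(** Moving negative terms across reduces the claim to two G-sets with equally many fixed points
    under every subgroup. *)
Lemma mark_inj (a b : burnside G) :
  (forall P : {group gT}, P \subset G -> mark G P a = mark G P b) -> a = b.
Proof.
have [X [Y ea]] := gclsBE a; have [Z [W eb]] := gclsBE b => mE.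
apply/eqP; rewrite ea eb subr_eq addrAC eq_sym subr_eq eq_sym -!gclsD.
apply/eqP/gcls_iso/gset_iso_fix => P sPG.
apply/eqP; rewrite -(eqr_nat int) -!markE // !gclsD !rmorphD /=.
have := mE P sPG; rewrite ea eb !rmorphB /= => /eqP.
by rewrite subr_eq addrAC eq_sym subr_eq eq_sym.
Qed.

End Marks.

(** * Congruences between marks *)

Section Congruences.
Variables (gT : finGroupType) (G : {group gT}).
Implicit Types (H K L P Q : {group gT}) (X : gset G).
Local Open Scope ring_scope.

Lemma afix_joing_cycle X H g : H \subset G -> g \in G ->
  'Fix_(gset_act X)(H <*> <[g]>)%g =
    ('Fix_(gset_act X)(H) :&: 'Fix_(gset_act X)([set g]))%g.
Proof. by move=> sHG Gg; rewrite afixYin ?cycle_subG // afix_cycle_in. Qed.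

(** Orbit counting: [Q] normalizes [H], so it acts on the [H]-fixed points of a G-set, and the sum
    is [#|Q|] times the number of orbits. *)
Lemma mark_sum_dvd H Q (x : burnside G) : H \subset G -> Q \subset 'N_G(H)%g ->
  (#|Q|%:Z %| \sum_(g in Q) mark G (H <*> <[g]>)%G x)%Z.
Proof.
move=> sHG; rewrite subsetI => /andP[sQG nHQ].
suff dvdX (X : gset G) :
    (#|Q|%:Z %| \sum_(g in Q) mark G (H <*> <[g]>)%G (@gcls (gset_rig G) X))%Z.
  have [X [Y ->]] := gclsBE x.
  rewrite (eq_bigr _ (fun g _ => rmorphB (mark G (H <*> <[g]>)%G) _ _)) sumrB.
  by apply: rpredB.
have inG := fintype.subsetP sQG.
rewrite (eq_bigr (fun g => #|('Fix_(gset_act X)(H) :&: 'Fix_(gset_act X)([set g]))%g|%:Z)).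
  rewrite -(big_morph _ PoszD (erefl _)) Frobenius_Cauchy ?PoszM ?dvdz_mull //.
  rewrite -{1}(finset.setIidPr sHG).
  by apply: fintype.subset_trans (acts_subnorm_fix _ _); rewrite subsetI sQG.
move=> g Qg; rewrite markE /=; last by rewrite join_subG sHG cycle_subG inG.
by rewrite afix_joing_cycle ?inG // natz.
Qed.

Lemma gset_rcosets_acts H :
  G \subset 'N(rcosets H G | 'Rs \ subsetT G)%g.
Proof. by rewrite acts_ract fintype.subxx actsRs_rcosets. Qed.

(** The transitive G-set of right cosets, found among the subsets of the ambient group under right
    translation. *)
Definition gset_rcosets H : gset G :=
  gset_sub (X := GSet ('Rs \ subsetT G)%act) (gset_rcosets_acts H).

(** A diagonal entry of the table of marks: [H] fixes the coset of [g] exactly when [g] normalizes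
    [H]. *)
Lemma mark_rcosets_norm H : H \subset G ->
  mark G H (@gcls (gset_rig G) (gset_rcosets H)) = #|'N_G(H) : H|%g%:Z.
Proof.
move=> sHG; rewrite markE // natz; congr Posz.
by rewrite card_fix_gset_sub // afix_ract afixRs_rcosets.
Qed.

(** Triangularity of the table of marks: the stabilizer of the coset of [g] is the conjugate of [H]
    by [g]. *)
Lemma mark_rcosets_neq0 H K : K \subset G ->
  mark G K (@gcls (gset_rig G) (gset_rcosets H)) != 0 ->
  exists2 g, g \in G & K \subset (H :^ g)%g.
Proof.
move=> sKG; rewrite markE // natz card_fix_gset_sub // afix_ract.
rewrite -lt0n => /card_gt0P[A /setIP[/rcosetsP[g Gg ->]]].
by rewrite sub_afixRs_norms => sK; exists g.
Qed.

Lemma mark_conj (x : burnside G) H g : H \subset G -> g \in G ->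
  mark G (H :^ g)%G x = mark G H x.
Proof.
move=> sHG Gg; have sHgG : (H :^ g)%G \subset G by rewrite /= conj_subG.
have [X [Y ->]] := gclsBE x.
by rewrite !rmorphB /= !markE //= !card_fix_conj.
Qed.

(** As [H] is normal in its normalizer, [Q :&: H] is Sylow in [H], so its index in [Q] is the
    [q]-part of [#|'N_G(H) : H|]. *)
Lemma dvdz_index_Sylow q H Q (m : int) : prime q -> H \subset G ->
  (q.-Sylow('N_G(H)) Q)%g -> (#|Q|%:Z %| #|Q :&: H|%g%:Z * m)%Z ->
  (#|'N_G(H) : H|%g`_q %| `|m|)%N.
Proof.
move=> q_pr sHG sylQ; rewrite dvdzE abszM /=.
have nHN : (H <| 'N_G(H))%g by rewrite normalSG.
have sylI := Sylow_setI_normal nHN sylQ.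
rewrite -(Lagrange (subsetIl Q H)) dvdn_pmul2l ?cardG_gt0 //; congr (_ %| _)%N.
have sHN := normal_sub nHN.
apply/eqP; rewrite -(eqn_pmul2l (cardG_gt0 (Q :&: H)%G)) Lagrange ?subsetIl //=.
rewrite (finset.setIC Q H) (card_Hall sylI) (card_Hall sylQ).
by rewrite -partnM ?cardG_gt0 ?indexg_gt0 // Lagrange.
Qed.

(** Summing over a Sylow subgroup of N_G(H), instead of over N_G(H) / H as in
    Dress's congruences, avoids cosets; this is enough because the index of H in
    N_G(H) divides [psi H] as soon as its q-part does for all q. *)
Theorem burnside_congruence (psi : {group gT} -> int) :
    (forall H g, H \subset G -> g \in G -> psi (H :^ g)%G = psi H) ->
    (forall q H Q, prime q -> H \subset G -> (q.-Sylow('N_G(H)) Q)%g ->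
      (#|Q|%:Z %| \sum_(g in Q) psi (H <*> <[g]>)%G)%Z) ->
  exists a : burnside G, forall H, H \subset G -> mark G H a = psi H.
Proof.
(* Induction on a set [D] of subgroups, closed under conjugation and passage to subgroups, outside
   which the family vanishes. *)
pose closed (D : {set {group gT}}) := [/\ forall K, K \in D -> K \subset G &
  forall K L g, K \in D -> g \in G -> L \subset (K :^ g)%g -> L \in D].
suff main n (D : {set {group gT}}) psi' : (#|D| < n)%N -> closed D ->
    (forall H g, H \subset G -> g \in G -> psi' (H :^ g)%G = psi' H) ->
    (forall q H Q, prime q -> H \subset G -> (q.-Sylow('N_G(H)) Q)%g ->
      (#|Q|%:Z %| \sum_(g in Q) psi' (H <*> <[g]>)%G)%Z) ->
    (forall H, H \subset G -> H \notin D -> psi' H = 0) ->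
    exists a : burnside G, forall H, H \subset G -> mark G H a = psi' H.
  move=> psiJ psi_dvd.
  apply: (main _ (subgroups G) psi (ltnSn _)) => // [|H sHG]; last by rewrite inE sHG.
  split=> [K|K L g]; rewrite !inE // => sKG Gg sL.
  by apply: fintype.subset_trans sL _; rewrite conj_subG.
elim: n D psi' => // n IHn D psi' leDn [sDG Dcl] psiJ psi_dvd psiD.
case: (pickP (mem D)) => [H0 DH0|D0]; last first.
  exists 0 => H sHG; rewrite rmorph0 psiD //; exact/negbT/D0.
have [H DH H_max] : exists2 H, H \in D & forall K, K \in D -> (#|K| <= #|H|)%N.
  by case: (arg_maxnP (fun K : {group gT} => #|K|) DH0) => H DH H_max; exists H.
have sHG := sDG H DH.
have k_ex : exists k, psi' H = k * #|'N_G(H) : H|%g%:Z.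
  apply/dvdzP; rewrite dvdzE /=; apply/dvdn_partP; first exact: indexg_gt0.
  move=> q; rewrite mem_primes => /andP[q_pr _].
  have [Q sylQ] := Sylow_exists q 'N_G(H)%G.
  apply: (dvdz_index_Sylow q_pr sHG sylQ); have := psi_dvd q H Q q_pr sHG sylQ.
  have sQG : Q \subset G := fintype.subset_trans (pHall_sub sylQ) (subsetIl _ _).
  (* For [g] outside [H], the join of [H] and [g] is too large to be in [D], so its term is 0; the
     other [#|Q :&: H|] terms equal [psi' H]. *)
  rewrite (bigID (mem H)) /= [X in _ + X]big1 ?addr0 => [|g /andP[Qg Hg]].
    rewrite (eq_bigr (fun=> psi' H)) => [|g /andP[_ Hg]].
      by rewrite sumr_const -mulr_natl natz (eq_card (fun g => in_setI g Q H)).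
    by congr psi'; apply/group_inj/joing_idPl; rewrite cycle_subG.
  have sJG : (H <*> <[g]>)%G \subset G.
    by rewrite join_subG sHG cycle_subG (fintype.subsetP sQG).
  apply: psiD => //; apply: contra Hg => /H_max leJ.
  have /eqP -> : H == (H <*> <[g]>)%G :> {set gT}.
    by rewrite eqEcard joing_subl.
  by rewrite /= -cycle_subG joing_subr.
have [k psiH] := k_ex.
(* The mark of [x] at [H] is [psi' H], and its marks outside [D] vanish; subtracting [x] removes the
   conjugates of [H] from the support. *)
pose x : burnside G := @gcls (gset_rig G) (gset_rcosets H) *~ k.
pose D' := D :\: [set (H :^ g)%G | g in G].
have xE K : mark G K x = mark G K (@gcls (gset_rig G) (gset_rcosets H)) * k.
  by rewrite raddfMz -mulrzr intz.
have [a aE] : exists a : burnside G, forall K, K \subset G ->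
    mark G K a = psi' K - mark G K x.
  apply: (IHn D').
  - apply: (@leq_trans #|D|); last by rewrite -ltnS.
    apply/proper_card/properP; split; first exact: subsetDl.
    exists H => //; rewrite !inE DH andbT negbK; apply/imsetP; exists 1%g => //.
    by apply: group_inj; rewrite /= conjsg1.
  (* If [L] is conjugate to [H] and contained in a conjugate of [K], maximality of [#|H|] makes [L]
     that conjugate, so [K] is conjugate to [H]. *)
  - split=> [K|K L g]; rewrite inE => /andP[KH DK]; first exact: sDG.
    move=> Gg sL; rewrite inE (Dcl K L g) // andbT; apply: contra KH.
    case/imsetP=> h Gh eL; apply/imsetP; exists (h * g^-1)%g; first by rewrite groupM ?groupV.
    apply: group_inj; rewrite /= conjsgM.
    apply/eqP; rewrite eq_sym -(inj_eq (can_inj (conjsgK g))) conjsgKV.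
    have -> : (H :^ h)%g = L by rewrite eL.
    by rewrite eqEcard sL cardJg eL /= cardJg H_max.
  - by move=> K g sKG Gg; rewrite psiJ // mark_conj.
  - move=> q K Q q_pr sKG sylQ; rewrite sumrB; apply: rpredB; first exact: psi_dvd sylQ.
    exact: mark_sum_dvd sKG (pHall_sub sylQ).
  - move=> K sKG; rewrite inE negb_and negbK => /orP[/imsetP[g Gg ->]|DK].
      by rewrite psiJ // mark_conj // psiH xE mark_rcosets_norm // mulrC subrr.
    rewrite psiD // xE; case: (eqVneq (mark G K (@gcls (gset_rig G) (gset_rcosets H))) 0) => [->|].
      by rewrite mul0r subrr.
    case/(mark_rcosets_neq0 sKG) => g Gg sK.
    by case/negP: DK; apply: (Dcl H K g).
by exists (a + x) => K sKG; rewrite rmorphD /= aE // subrK.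
Qed.

End Congruences.

(** * The section of the restriction map *)

Section SylowJoin.
Variables (gT : finGroupType) (p : nat).
Implicit Types H P Q R : {group gT}.
Local Open Scope group_scope.

(** The subgroups [H] and [H :&: P] meet the cycle of [x] alike, so adjoining [x] to both leaves the
    index unchanged. *)
Lemma Sylow_joing_cycle H P x : P \subset 'N(H) -> p.-group P ->
  p.-Sylow(H) (H :&: P) -> x \in P ->
  p.-Sylow(H <*> <[x]>) ((H :&: P) <*> <[x]>).
Proof.
move=> nHP pP sylR Px; have sXP : <[x]> \subset P by rewrite cycle_subG.
have nHX := fintype.subset_trans sXP nHP.
have nRX : <[x]> \subset 'N(H :&: P).
  by apply: fintype.subset_trans sXP _; rewrite normsI // normG.
have sRX_HX : (H :&: P) <*> <[x]> \subset H <*> <[x]>.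
  by apply: genS; apply: finset.setSU; apply: subsetIl.
rewrite /pHall sRX_HX /=; apply/andP; split.
  by apply: pgroupS pP; rewrite join_subG subsetIr.
have <- : #|H : H :&: P| = #|H <*> <[x]> : (H :&: P) <*> <[x]>|.
  have eI : (H :&: P) :&: <[x]> = H :&: <[x]>.
    by rewrite -finset.setIA (finset.setIidPr sXP).
  have eH : (#|H| * #|<[x]>| = #|H <*> <[x]>| * #|H :&: <[x]>|)%N.
    by rewrite norm_joinEr // mul_cardG.
  have eR : (#|H :&: P| * #|<[x]>| = #|(H :&: P) <*> <[x]>| * #|H :&: <[x]>|)%N.
    by rewrite norm_joinEr // mul_cardG eI.
  apply/eqP; rewrite -(eqn_pmul2l (cardG_gt0 ((H :&: P) <*> <[x]>))).
  rewrite -(eqn_pmul2r (cardG_gt0 (H :&: <[x]>))) Lagrange //.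
  by rewrite mulnAC -eR mulnAC Lagrange ?subsetIl // eH.
by case/and3P: sylR.
Qed.

(** The index of [H] in the join divides the order of [x], a power of [q], hence is prime to [p]. *)
Lemma Sylow_joing_cycle_p' q H Q R x : q != p -> q.-group Q ->
  Q \subset 'N(H) -> p.-Sylow(H) R -> x \in Q -> p.-Sylow(H <*> <[x]>) R.
Proof.
move=> npq qQ nHQ sylR Qx; have [sRH pR p'R] := and3P sylR.
have sHX : H \subset H <*> <[x]> := joing_subl _ _.
rewrite /pHall (fintype.subset_trans sRH sHX) pR /=.
rewrite -(Lagrange_index sHX sRH) pnatM p'R andbT.
have nHX : <[x]> \subset 'N(H) by apply: fintype.subset_trans nHQ; rewrite cycle_subG.
have sHXN : H <*> <[x]> \subset 'N(H) by rewrite join_subG normG.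
rewrite -card_quotient // quotientYidl //.
have /pnat_dvd : #|<[x]> / H| %| #|<[x]>| := dvdn_quotient _ _.
apply; apply: (@sub_in_pnat q); last by apply: pgroupS qQ; rewrite cycle_subG.
by move=> r _ /eqP ->; rewrite inE /= inE.
Qed.
End SylowJoin.

Section Transfer.
Variables (gT : finGroupType) (G S : {group gT}) (p : nat).
Hypothesis sylS : (p.-Sylow(G) S)%g.
Implicit Types (H P Q R : {group gT}) (a : burnside_fusion G S).
Local Open Scope ring_scope.

Let sSG : S \subset G := pHall_sub sylS.

Lemma bf_val_stable a P Q g : P \subset S -> Q \subset S -> g \in G ->
  Q = (P :^ g)%G -> mark S P (bf_val a) = mark S Q (bf_val a).
Proof. by case: a => a /= /asboolP h sPS sQS Gg e; apply: h => //; exists g. Qed.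

Lemma Sylow_conj_sub H : H \subset G ->
  exists R g, [/\ (p.-Sylow(H) R)%g, g \in G & (R :^ g)%g \subset S].
Proof.
move=> sHG; have [R sylR] := Sylow_exists p H.
have sRG := fintype.subset_trans (pHall_sub sylR) sHG.
have [g Gg sRS] := Sylow_Jsub sylS sRG (pHall_pgroup sylR).
by exists R, g.
Qed.

Definition Sylow_conj_in H Q :=
  Q \subset S /\ exists R g, [/\ (p.-Sylow(H) R)%g, g \in G & Q = (R :^ g)%G].

(** For [H] inside [G] such a [Q] exists by Sylow's theorem, so the default is never reached; stable
    elements do not see the choice of [Q]. *)
Definition Sylow_rep H : {group gT} :=
  if pselect (exists Q, Sylow_conj_in H Q) is left e then projT1 (cid e) else 1%G.

(** Sylow subgroups of [H] are conjugate in [H], so their conjugates inside [S] are [G]-conjugate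
    and stability of [a] applies. *)
Lemma mark_Sylow_rep a H R g : H \subset G -> (p.-Sylow(H) R)%g -> g \in G ->
  (R :^ g)%g \subset S ->
  mark S (Sylow_rep H) (bf_val a) = mark S (R :^ g)%G (bf_val a).
Proof.
move=> sHG sylR Gg sRS; rewrite /Sylow_rep; case: pselect => [e|[]]; last first.
  by exists (R :^ g)%G; split=> //; exists R, g.
case: cid => Q /= [sQS [R1 [g1 [sylR1 Gg1 eQ]]]]; subst Q.
have [h Hh eR] := Sylow_trans sylR sylR1.
have Gh := fintype.subsetP sHG h Hh.
apply: esym; apply: (@bf_val_stable _ _ _ (g^-1 * h * g1)%g) => //.
  by rewrite !groupM ?groupV.
by apply: group_inj; rewrite /= eR !conjsgM conjsgK.
Qed.

Lemma mark_Sylow_rep_conj a H g : H \subset G -> g \in G ->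
  mark S (Sylow_rep (H :^ g)%G) (bf_val a) = mark S (Sylow_rep H) (bf_val a).
Proof.
move=> sHG Gg; have [R [h [sylR Gh sRS]]] := Sylow_conj_sub sHG.
rewrite (mark_Sylow_rep _ sHG sylR Gh sRS).
have eR : ((R :^ g) :^ (g^-1 * h) = R :^ h)%g by rewrite conjsgM conjsgK.
rewrite (@mark_Sylow_rep _ _ (R :^ g)%G (g^-1 * h)%g) /= ?eR //.
- by congr (mark S _ _); apply: group_inj.
- by rewrite conj_subG.
- by rewrite pHallJ2.
- by rewrite groupM ?groupV.
Qed.

Lemma sum_mark_Sylow_rep_dvd a q H Q : prime q -> H \subset G ->
    (q.-Sylow('N_G(H)) Q)%g ->
  (#|Q|%:Z %| \sum_(x in Q) mark S (Sylow_rep (H <*> <[x]>)%G) (bf_val a))%Z.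
Proof.
move=> q_pr sHG sylQ; have [sQN qQ _] := and3P sylQ.
have [sQG nHQ] := (fintype.subset_trans sQN (subsetIl _ _),
                   fintype.subset_trans sQN (subsetIr _ _)).
have sJG x : x \in Q -> (H <*> <[x]>)%g \subset G.
  by move=> Qx; rewrite join_subG sHG cycle_subG (fintype.subsetP sQG).
have [eqp|nqp] := eqVneq q p; last first.
  (* For [q != p], one Sylow [p]-subgroup of [H] serves all the joins, and the sum is constant. *)
  have [R [g [sylR Gg sRS]]] := Sylow_conj_sub sHG.
  rewrite (eq_bigr (fun=> mark S (R :^ g)%G (bf_val a))) => [|x Qx].
    by rewrite sumr_const -mulr_natl natz dvdz_mulr.
  apply: mark_Sylow_rep => //; first exact: sJG.
  exact: Sylow_joing_cycle_p' nqp qQ nHQ sylR Qx.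
subst q; have [c Gc sQS] := Sylow_Jsub sylS sQG qQ.
have nHN : (H <| 'N_G(H))%g by rewrite normalSG.
have sylR := Sylow_setI_normal nHN sylQ.
pose R := (H :&: Q)%G.
have sRcS : (R :^ c)%g \subset S.
  by apply: fintype.subset_trans sQS; rewrite conjSg subsetIr.
have nRQ : (Q :^ c)%g \subset 'N_S(R :^ c)%g.
  by rewrite subsetI sQS /= normJ conjSg normsI // normG.
(* For [q = p], conjugation by [c] turns the sum into an orbit count inside [S], as [R <*> <[x]>] is
   Sylow in [H <*> <[x]>]. *)
have := @mark_sum_dvd _ S (R :^ c)%G (Q :^ c)%G (bf_val a) sRcS nRQ.
rewrite cardJg; congr (_ %| _)%Z.
rewrite (reindex_inj (conjg_inj c)) /=.
apply: eq_big => [x|x Qx]; first by rewrite memJ_conjg.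
have eJ : ((R <*> <[x]>) :^ c = (R :^ c) <*> <[x ^ c]>)%g.
  by rewrite conjYg conjsgE cycleJ.
rewrite memJ_conjg in Qx.
rewrite (@mark_Sylow_rep _ _ (R <*> <[x]>)%G c) /= ?eJ ?sJG //.
- by congr (mark S _ _); apply: group_inj.
- exact: Sylow_joing_cycle.
- rewrite join_subG sRcS cycle_subG; apply: (fintype.subsetP sQS).
  by rewrite memJ_conjg.
Qed.

Lemma transfer_ex a : exists b : burnside G, forall H, H \subset G ->
  mark G H b = mark S (Sylow_rep H) (bf_val a).
Proof.
apply: burnside_congruence => [H g|q H Q]; first exact: mark_Sylow_rep_conj.
exact: sum_mark_Sylow_rep_dvd.
Qed.

Definition transfer_fun a : burnside G := projT1 (cid (transfer_ex a)).

Lemma mark_transfer a H : H \subset G ->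
  mark G H (transfer_fun a) = mark S (Sylow_rep H) (bf_val a).
Proof. by rewrite /transfer_fun; case: cid => b h /h. Qed.

Lemma transfer_zmod : zmod_morphism transfer_fun.
Proof.
move=> a b; apply: mark_inj => H sHG.
by rewrite rmorphB /= !mark_transfer // -rmorphB.
Qed.

Lemma transfer_monoid : monoid_morphism transfer_fun.
Proof.
split=> [|a b]; apply: mark_inj => H sHG.
  by rewrite mark_transfer // !rmorph1.
by rewrite rmorphM /= !mark_transfer // -rmorphM.
Qed.

HB.instance Definition _ := GRing.isZmodMorphism.Build
  (burnside_fusion G S) (burnside G) transfer_fun transfer_zmod.
HB.instance Definition _ := GRing.isMonoidMorphism.Build
  (burnside_fusion G S) (burnside G) transfer_fun transfer_monoid.
Definition burnside_transfer : {rmorphism burnside_fusion G S -> burnside G} := transfer_fun.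

Lemma mark_res (x : burnside G) P : P \subset S ->
  mark S P (burnside_res sSG x) = mark G P x.
Proof.
move=> sPS; have [X [Y ->]] := gclsBE x.
have sPG := fintype.subset_trans sPS sSG.
rewrite (rmorphB (burnside_res sSG)) !burnside_resE (rmorphB (mark S P)).
by rewrite (rmorphB (mark G P)) !markE.
Qed.

Lemma burnside_resFK a : burnside_resF sSG (burnside_transfer a) = a.
Proof.
apply: val_inj; apply: mark_inj => P sPS /=.
have sPG := fintype.subset_trans sPS sSG.
rewrite mark_res // mark_transfer // (@mark_Sylow_rep _ _ P 1%g) //.
- by congr (mark S _ _); apply: group_inj; rewrite /= conjsg1.
- by rewrite /pHall fintype.subxx (pgroupS sPS (pHall_pgroup sylS)) indexgg.
- by rewrite conjsg1.
Qed.

End Transfer.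

(** * Fixed points and permutation modules *)

Section FixedSum.
Local Open Scope ring_scope.
Variables (F : fieldType) (p : nat) (gT : finGroupType) (P : {group gT}).
Hypotheses (charF : p \in [pchar F]) (pP : (p.-group P)%g).

(** On an orbit without fixed points [c] is constant, and the size of the orbit is a positive power
    of [p], which is 0 in [F]. *)
Lemma sum_fix_pgroup (X : gset P) (c : X -> F) :
  {in P, forall g x, c (gset_act X x g) = c x} ->
  \sum_x c x = \sum_(x in 'Fix_(gset_act X)(P)%g) c x.
Proof.
move=> cP; set A := 'Fix_(gset_act X)(P)%g.
have actsA : (P \subset 'N(A | gset_act X))%g.
  have := acts_subnorm_fix (gset_act X) P.
  by rewrite finset.setIid (finset.setIidPl (normG P)).
have actsC : (P \subset 'N(~: A | gset_act X))%g by rewrite astabsC.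
rewrite (bigID (mem A)) /= [X in _ + X](_ : _ = 0) ?addr0 //.
rewrite (eq_bigl (mem (~: A))) => [|x]; last by rewrite !inE.
rewrite (set_partition_big _ (orbit_partition actsC)) big1 // => _ /imsetP[x Ax ->].
rewrite (eq_bigr (fun=> c x)) => [|_ /orbitP[g Pg <-]]; last exact: cP.
rewrite sumr_const -mulr_natl; apply/eqP; rewrite mulf_eq0.
have : (p.-nat #|orbit (gset_act X) P x|)%N.
  by apply: pnat_dvd pP; rewrite -(card_orbit_in_stab (gset_act X) x (fintype.subxx P)) dvdn_mulr.
case/p_natP => -[|k] ek.
  have /card_orbit1 fx := ek.
  move: Ax; rewrite inE => /negP[]; apply/afixP => g Pg; apply/set1P.
  by rewrite -fx mem_orbit.
by rewrite ek expnS natrM (pcharf0 charF) mul0r eqxx.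
Qed.
End FixedSum.

Section PermModFixed.
Variables (O : comPzRingType) (gT : finGroupType).
Implicit Types G P : {group gT}.
Local Open Scope ring_scope.

Lemma dlt_act G (X : gset G) x g : g \in G ->
  dlt O (gset_act X x g) = ogm_act (dlt O x : permMod O X) g.
Proof.
move=> Gg; apply/ffunP=> z; rewrite !ffunE; congr ((nat_of_bool _)%:R).
apply/eqP/eqP => [<-|->]; last by rewrite -actMin ?groupV // mulVg act1.
by rewrite -actMin ?groupV // mulgV act1.
Qed.

Lemma permMod_lin_coef G (X Y : gset G) (f : permMod O X -> permMod O Y) :
  linear f -> {in G, forall g v, f (ogm_act v g) = ogm_act (f v) g} ->
  {in G, forall g x y,
    f (dlt O (gset_act X x g)) (gset_act Y y g) = f (dlt O x) y}.
Proof.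
move=> lf fG g Gg x y; rewrite dlt_act // fG // ffunE.
by rewrite -actMin ?groupV // mulgV act1.
Qed.

Lemma permMod_lin_comp (X Y Z : finType) (f : {ffun X -> O^o} -> {ffun Y -> O^o})
    (h : {ffun Y -> O^o} -> {ffun Z -> O^o}) x z : linear h ->
  h (f (dlt O x)) z = \sum_y (f (dlt O x) y : O) * (h (dlt O y) z : O).
Proof.
move=> lh; rewrite {1}[f _]dlt_sum (lin_sum _ _ lh) sum_ffunE.
by apply: eq_bigr => y _; rewrite ffunE.
Qed.

Variables (F : fieldType) (p : nat) (red : {rmorphism O -> F}).
Hypothesis charF : p \in [pchar F].

(** Over a p-group, the entries of the product of two equivariant matrices at
    pairs of fixed points are, modulo p, those of the product of the submatrices
    indexed by fixed points. *)
Lemma card_fix_permMod_le P (X Y : gset P) : (p.-group P)%g ->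
  ogiso (permMod O X) (permMod O Y) ->
  (#|'Fix_(gset_act X)(P)%g| <= #|'Fix_(gset_act Y)(P)%g|)%N.
Proof.
move=> pP /ogiso_inv[f [f' [[lf lf'] [fK f'K] fG f'G]]].
pose a x y : F := red (f (dlt O x) y); pose b y x : F := red (f' (dlt O y) x).
have aG := permMod_lin_coef lf fG; have bG := permMod_lin_coef lf' f'G.
pose A := \matrix_(i < #|'Fix_(gset_act X)(P)%g|, j < #|'Fix_(gset_act Y)(P)%g|)
  a (enum_val i) (enum_val j).
pose B := \matrix_(j < #|'Fix_(gset_act Y)(P)%g|, i < #|'Fix_(gset_act X)(P)%g|)
  b (enum_val j) (enum_val i).
(* A product [A *m B] equal to the identity bounds the size of [A]. *)
apply: (@mulmx1_min F _ _ A B); apply/matrixP => i k; rewrite !mxE.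
under eq_bigr => j _ do rewrite !mxE.
rewrite -(big_enum_val (fun y => a (enum_val i) y * b y (enum_val k))).
rewrite -(sum_fix_pgroup charF pP) => [|g Pg y]; last first.
  have /afixP/(_ g Pg) ei := enum_valP i; have /afixP/(_ g Pg) ek := enum_valP k.
  by rewrite /a /b -{1}ei -{1}ek aG // bG.
rewrite -(inj_eq enum_val_inj).
have := permMod_lin_comp f (enum_val i) (enum_val k) lf'.
rewrite fK ffunE => /(congr1 red); rewrite rmorph_sum rmorph_nat => ->.
by apply: eq_bigr => y _; rewrite rmorphM.
Qed.

Lemma card_fix_permMod P (X Y : gset P) : (p.-group P)%g ->
  ogiso (permMod O X) (permMod O Y) ->
  #|'Fix_(gset_act X)(P)%g| = #|'Fix_(gset_act Y)(P)%g|.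
Proof.
move=> pP iXY; apply/eqP; rewrite eqn_leq !card_fix_permMod_le //.
exact: ogiso_sym.
Qed.

(** Equal classes are isomorphic after adding some [Z]; completing [Z] to a permutation module on
    [W] gives permutation modules on both sides, and the fixed points of [W] cancel. *)
Lemma gcls_permMod_fix (S P : {group gT}) (X Y : gset S) :
    P \subset S -> (p.-group P)%g ->
    gcls (pp_perm O X : pperm_rig O S) = gcls (pp_perm O Y : pperm_rig O S) ->
  #|'Fix_(gset_act X)(P)%g| = #|'Fix_(gset_act Y)(P)%g|.
Proof.
move=> sPS pP /gcls_eq[Z iXY]; have [_ [W [N iZ]]] := pp_modP Z.
have step (X' Y' : gset S) : rc_iso (rc_sum (pp_perm O X' : pperm_rig O S) Z)
      (rc_sum (pp_perm O Y' : pperm_rig O S) Z) ->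
    ogiso (permMod O (gset_sum X' W)) (permMod O (gset_sum Y' W)).
  have iW X'' : ogiso (permMod O (gset_sum X'' W))
      (ogm_dsum (ogm_dsum (permMod O X'') Z) N).
    apply: (ogiso_trans (permMod_sum _ _ _)).
    apply: (ogiso_trans _ (ogm_dsumA _ _ _)).
    exact: ogm_dsum_iso (ogiso_refl _) (ogiso_sym iZ).
  move=> i; apply: (ogiso_trans (iW X')); apply: (ogiso_trans _ (ogiso_sym (iW Y'))).
  exact: ogm_dsum_iso i (ogiso_refl _).
have iP := ogm_res_iso sPS (step _ _ iXY).
have := card_fix_permMod pP (ogiso_trans (ogiso_sym (ogm_res_perm O sPS _))
  (ogiso_trans iP (ogm_res_perm O sPS _))).
by rewrite /= !afix_ract !card_fix_sum // => /addIn.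
Qed.

Lemma lam_inj (S : {group gT}) : (p.-group S)%g -> injective (lam O S).
Proof.
move=> pS a b; have [X [Y ->]] := gclsBE a; have [Z [W ->]] := gclsBE b => e.
have {}e : lam O S (gcls X + gcls W) = lam O S (gcls Z + gcls Y).
  move: e; rewrite !rmorphB !rmorphD => /eqP.
  by rewrite subr_eq addrAC eq_sym subr_eq eq_sym => /eqP.
apply/eqP; rewrite subr_eq addrAC eq_sym subr_eq eq_sym.
apply/eqP; move: e; rewrite -!gclsD !lamE => e; apply: mark_inj => P sPS.
by rewrite !markE // (gcls_permMod_fix sPS (pgroupS sPS pS) e).
Qed.
End PermModFixed.

(** * Conjugation in G and stability of restrictions to S *)

Section Conjugation.
Variables (gT : finGroupType) (S P : {group gT}) (g : gT).
Hypothesis sPgS : (P :^ g)%g \subset S.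
Local Open Scope group_scope.

Lemma gset_conj_in h : h \in P -> h ^ g \in S.
Proof. by move=> Ph; apply: (fintype.subsetP sPgS); rewrite memJ_conjg. Qed.

Lemma gset_conj_is_action (X : gset S) :
  is_action P (fun x h => gset_act X x (h ^ g)).
Proof.
split=> [h x y /act_inj //|x h k Ph Pk].
by rewrite conjMg actMin ?gset_conj_in.
Qed.

(** The pullback of [X] along conjugation by [g], which lets marks at [P] and [P :^ g] be compared
    over the single group [P]. *)
Definition gset_conj (X : gset S) : gset P := GSet (Action (gset_conj_is_action X)).

Lemma card_fix_gset_conj (X : gset S) :
  #|'Fix_(gset_act (gset_conj X))(P)| = #|'Fix_(gset_act X)(P :^ g)|.
Proof.
apply: eq_card => x; apply/afixP/afixP => [xP h|xP h Ph].
  by case/imsetP => k Pk ->; apply: xP.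
by apply: xP; rewrite memJ_conjg.
Qed.
End Conjugation.

Section Stability.
Local Open Scope ring_scope.
Variables (O : comPzRingType) (F : fieldType) (p : nat) (red : {rmorphism O -> F}).
Variables (gT : finGroupType) (G S : {group gT}) (sSG : S \subset G).
Hypotheses (charF : p \in [pchar F]).

(** The action of [g] on [M] is an isomorphism of the permutation [P]-module on [X] with the one on
    its pullback along conjugation by [g]. *)
Lemma card_fix_res_conj (M : ogmod O G) (X : gset S) (P : {group gT}) g :
    ogiso (ogm_res sSG M) (permMod O X) -> (p.-group P)%g -> P \subset S -> g \in G ->
    (P :^ g)%g \subset S ->
  #|'Fix_(gset_act X)(P)%g| = #|'Fix_(gset_act X)(P :^ g)%g|.
Proof.
move=> /ogiso_inv[f [f' [[lf lf'] [fK f'K] fG f'G]]] pP sPS Gg sPgS.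
rewrite -(card_fix_gset_conj sPgS) -(afix_ract _ sPS).
apply: (@card_fix_permMod O gT F p red charF P (gset_res sPS X)) => //.
have actL h : h \in G -> linear (fun m : M => ogm_act m h) by move=> /ogm_actL.
pose A h v := f (@ogm_act O gT G M (f' v) h).
apply: (@ogisoI _ _ _ (permMod O (gset_res sPS X)) (permMod O (gset_conj sPgS X))
  (A g) (A g^-1)%g).
- by move=> a u v; rewrite /A lf' actL // lf.
- by move=> v; rewrite /A fK -ogm_actM ?groupV // mulgV ogm_act1 f'K.
- by move=> v; rewrite /A fK -ogm_actM ?groupV // mulVg ogm_act1 f'K.
move=> h Ph v; have Sh := fintype.subsetP sPS h Ph.
have Gh := fintype.subsetP sSG h Sh.
have -> : ogm_act (v : permMod O (gset_res sPS X)) h = ogm_act (v : permMod O X) h by [].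
have Shg := gset_conj_in sPgS Ph.
transitivity (ogm_act (A g v : permMod O X) (h ^ g)%g).
  rewrite /A f'G // -fG //=; congr (f _).
  by rewrite -!ogm_actM ?groupJ // conjgC.
by apply/ffunP=> x; rewrite !ffunE /= conjVg.
Qed.
End Stability.

(** * Summands of permutation modules of p-groups *)

Section Kernel.
Variables (O : comPzRingType) (gT : finGroupType) (G : {group gT}).
Local Open Scope ring_scope.

Record equivariant (M N : ogmod O G) := Equivariant {
  eqv_fun :> M -> N;
  eqv_lin : linear eqv_fun;
  eqv_act : {in G, forall g m, eqv_fun (ogm_act m g) = ogm_act (eqv_fun m) g} }.

Variables (M N : ogmod O G).
Implicit Type f : equivariant M N.

Definition eqv_ker f : {pred M} := fun m => f m == 0.

Lemma eqv_ker_closed f : submod_closed (eqv_ker f).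
Proof.
split=> [|a u v /eqP fu /eqP fv]; apply/eqP; first exact: lin0 (eqv_lin f).
by rewrite eqv_lin fu fv scaler0 addr0.
Qed.
HB.instance Definition _ f := GRing.isSubmodClosed.Build O M (eqv_ker f)
  (GRing.submod_closed_semi (@eqv_ker_closed f)).

Record ker_sort f := KerSort { ker_val : M; _ : ker_val \in eqv_ker f }.
HB.instance Definition _ f := [isSub for @ker_val f].
HB.instance Definition _ f := [Choice of ker_sort f by <:].
HB.instance Definition _ f := [SubChoice_isSubLmodule of ker_sort f by <:].

Lemma ker_valP f (m : ker_sort f) : f (ker_val m) = 0.
Proof. by case: m => m /= /eqP. Qed.

(** Equivariance is known only on [G]; elsewhere the identity keeps the action inside the kernel. *)
Lemma ker_act_subproof f (m : ker_sort f) g :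
  (if g \in G then ogm_act (ker_val m) g else ker_val m) \in eqv_ker f.
Proof.
case: ifP => Gg; apply/eqP; last exact: ker_valP.
by rewrite eqv_act // ker_valP; apply: (lin0 (f := (@ogm_act _ _ _ N)^~ g)); apply: ogm_actL.
Qed.
Definition ker_act f (m : ker_sort f) (g : gT) := KerSort (ker_act_subproof m g).

Lemma ker_actL f : {in G, forall g, linear ((@ker_act f)^~ g)}.
Proof. by move=> g Gg a u v; apply: val_inj; rewrite /= Gg ogm_actL. Qed.
Lemma ker_act1 f m : @ker_act f m 1%g = m.
Proof. by apply: val_inj; rewrite /= group1 ogm_act1. Qed.
Lemma ker_actM f : {in G &, forall g h m,
  @ker_act f m (g * h)%g = ker_act (ker_act m g) h}.
Proof. by move=> g h Gg Gh m; apply: val_inj; rewrite /= groupM // Gg Gh ogm_actM. Qed.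
Definition ogm_ker f : ogmod O G := OGMod (@ker_actL f) (@ker_act1 f) (@ker_actM f).

End Kernel.

Section Exchange.
Variables (O : comPzRingType) (gT : finGroupType) (G : {group gT}).
Implicit Types M N R : ogmod O G.
Local Open Scope ring_scope.

Lemma ogm_act0 M g : g \in G -> ogm_act (0 : M) g = 0.
Proof. by move=> Gg; apply: (lin0 (f := (@ogm_act _ _ _ M)^~ g)); apply: ogm_actL. Qed.

Lemma ogm_act_pairl M N g (m : M) : g \in G ->
  (ogm_act m g, 0) = ogm_act ((m, 0) : ogm_dsum M N) g.
Proof. by move=> Gg; rewrite /= /dsum_act /= ogm_act0. Qed.

Lemma ogm_act_pairr M N g (n : N) : g \in G ->
  (0, ogm_act n g) = ogm_act ((0, n) : ogm_dsum M N) g.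
Proof. by move=> Gg; rewrite /= /dsum_act /= ogm_act0. Qed.

(* [R], and the image under [phi] of [K + M2], where [K] is the kernel of the
   component M1 -> N of [phi], are complements in [N + R] of the same submodule,
   the image of the component N -> M1 of [psi]. *)
Lemma ogm_exchange M1 M2 N R (phi : M1 * M2 -> N * R) (psi : N * R -> M1 * M2)
    (u : N -> N) : linear phi -> cancel phi psi -> cancel psi phi ->
    {in G, forall g m, phi (ogm_act (m : ogm_dsum M1 M2) g) =
                       ogm_act (phi m : ogm_dsum N R) g} ->
    cancel (fun n => (phi ((psi (n, 0)).1, 0)).1) u ->
    cancel u (fun n => (phi ((psi (n, 0)).1, 0)).1) ->
  exists K, ogiso M1 (ogm_dsum N K) /\ ogiso (ogm_dsum K M2) R.
Proof.
move=> lphi phiK psiK phiG uK Ku.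
have lpsi : linear psi by apply: linear_inv lphi phiK psiK.
have psiG : {in G, forall g m, psi (ogm_act (m : ogm_dsum N R) g) =
                       ogm_act (psi m : ogm_dsum M1 M2) g}.
  by move=> g Gg m; rewrite -{1}(psiK m) -phiG // phiK.
pose i n := (psi (n, 0)).1; pose r m := (phi (m, 0)).1.
have li : linear i by move=> a x y; rewrite /i pairL lpsi.
have lr : linear r by move=> a x y; rewrite /r pairL lphi.
have iG : {in G, forall g n, i (ogm_act n g) = ogm_act (i n) g}.
  by move=> g Gg n; rewrite /i ogm_act_pairl // psiG.
have rG : {in G, forall g n, r (ogm_act n g) = ogm_act (r n) g}.
  by move=> g Gg n; rewrite /r ogm_act_pairl // phiG.
have {}uK n : u (r (i n)) = n by apply: uK.
have {}Ku n : r (i (u n)) = n by apply: Ku.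
have lu : linear u.
  have lri : linear (fun n => r (i n)) by move=> a x y; rewrite li lr.
  exact: (linear_inv lri uK Ku).
have uG : {in G, forall g n, u (ogm_act n g) = ogm_act (u n) g}.
  by move=> g Gg n; rewrite -{1}(Ku n) -rG // -iG // uK.
pose rE : equivariant M1 N := Equivariant lr rG.
(* Since [r i u] is the identity, [q] is the projection onto the kernel of [r] along the image of
   [i]. *)
pose q m := m - i (u (r m)).
have qK m : q m \in eqv_ker rE.
  by apply/eqP; rewrite /= /q (linD _ _ lr) (linN _ lr) Ku subrr.
have lq : linear q.
  move=> a x y; rewrite /q lr lu li scalerBr opprD addrACA.
  by [].
have qG : {in G, forall g m, q (ogm_act m g) = ogm_act (q m) g}.
  move=> g Gg m; rewrite /q rG // uG // iG //.
  have lg := @ogm_actL _ _ _ M1 g Gg.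
  by rewrite -(linN _ lg) -(linD _ _ lg).
pose K := ogm_ker rE; pose qq m : K := KerSort (qK m).
have lqq : linear qq by move=> a x y; apply: val_inj; rewrite /= lq.
have qqG : {in G, forall g m, qq (ogm_act m g) = ogm_act (qq m) g}.
  by move=> g Gg m; apply: val_inj; rewrite /= Gg qG.
have q_ker (k : K) : q (ker_val k) = ker_val k.
  have := ker_valP k; rewrite /q /= => ->.
  by rewrite (lin0 lu) (lin0 li) subr0.
have r_ker (k : K) : r (ker_val k) = 0 := ker_valP k.
exists K; split.
  apply: (@ogisoI _ _ _ M1 (ogm_dsum N K) (fun m => (u (r m), qq m))
    (fun v => i v.1 + ker_val v.2)).
  - by move=> a x y /=; rewrite lr lu lqq.
  - by move=> m /=; rewrite /q addrC subrK.
  - move=> [n k] /=; have rE' : r (i n + ker_val k) = r (i n).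
      by rewrite (linD _ _ lr) r_ker addr0.
    congr (_, _); first by rewrite rE' uK.
    by apply: val_inj; rewrite /= /q rE' uK addrC addKr.
  - by move=> g Gg m; rewrite /= rG // uG // qqG.
(* The image of [i] becomes the graph of [s] in [N * R]; [back] uses the projection onto [R] along
   this graph. *)
pose s n := (phi (i (u n), 0)).2.
have phi_iu n : phi (i (u n), 0) = (n, s n).
  by rewrite [LHS]surjective_pairing -[(phi _).1]/(r (i (u n))) Ku.
pose back (v : K * M2) := (phi (ker_val v.1, v.2)).2 - s (phi (ker_val v.1, v.2)).1.
apply: ogiso_sym.
apply: (@ogisoI _ _ _ R (ogm_dsum K M2)
  (fun x => (qq (psi (0, x)).1, (psi (0, x)).2)) back).
- by move=> a x y; rewrite pairR lpsi /= lqq.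
- move=> x; rewrite /back /=.
  set m := psi (0, x); have em : phi m = (0, x) by rewrite psiK.
  have -> : phi (q m.1, m.2) = phi m - phi (i (u (r m.1)), 0).
    rewrite -(linN _ lphi) -(linD _ _ lphi); congr phi.
    by rewrite [RHS]surjective_pairing /= oppr0 addr0.
  rewrite em phi_iu /=.
  have ls : linear s by move=> a y z; rewrite /s lu li pairL lphi.
  by rewrite sub0r (linN _ ls) opprK subrK.
- move=> [k m]; rewrite /back /=.
  set w := phi (ker_val k, m).
  have -> : psi (0, w.2 - s w.1) = (ker_val k - i (u w.1), m).
    apply: (can_inj phiK); rewrite psiK.
    have -> : (ker_val k - i (u w.1), m) = (ker_val k, m) - (i (u w.1), 0).
      by rewrite [RHS]surjective_pairing /= subr0.
    rewrite (linD _ _ lphi) (linN _ lphi) phi_iu -/w.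
    by rewrite [RHS]surjective_pairing /= subrr.
  congr (_, _); apply: val_inj => /=.
  rewrite (linD _ _ lq) (linN _ lq) q_ker /q uK subrr subr0.
  by [].
- move=> g Gg x.
  by rewrite ogm_act_pairr // psiG //= /dsum_act /= qqG.
Qed.

End Exchange.

(** * Equivariant endomorphisms of transitive permutation modules *)

Section TransitiveMatrix.
Local Open Scope ring_scope.
Variables (F : fieldType) (p : nat) (gT : finGroupType) (S : {group gT}).
Hypotheses (charF : p \in [pchar F]) (pS : (p.-group S)%g).
Variable T : gset S.

Definition perm_repr_mx (g : gT) : 'M[F]_#|T| :=
  \matrix_(i, j) (gset_act T (enum_val i) g == enum_val j)%:R.

Lemma mul_perm_repr_mx m g (A : 'M_(#|T|, m)) i j :
  (perm_repr_mx g *m A) i j = A (enum_rank (gset_act T (enum_val i) g)) j.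
Proof.
rewrite !mxE (bigD1 (enum_rank (gset_act T (enum_val i) g))) //= big1.
  by rewrite !mxE enum_rankK eqxx mul1r addr0.
move=> k nk; rewrite !mxE; case: eqP => [e|_]; last by rewrite mul0r.
by move: nk; rewrite e enum_valK eqxx.
Qed.

Lemma perm_mx_repr : mx_repr S perm_repr_mx.
Proof.
split=> [|g h Sg Sh]; apply/matrixP=> i j.
  by rewrite !mxE act1 (inj_eq enum_val_inj).
by rewrite mul_perm_repr_mx !mxE enum_rankK actMin.
Qed.
Canonical perm_representation := MxRepresentation perm_mx_repr.

Variable a : T -> T -> F.
Hypothesis aS : {in S, forall g x y, a (gset_act T x g) (gset_act T y g) = a x y}.
Let A := \matrix_(i < #|T|, j < #|T|) a (enum_val i) (enum_val j).

Lemma perm_repr_mxC g : g \in S -> perm_repr_mx g *m A = A *m perm_repr_mx g.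
Proof.
move=> Sg; apply/matrixP=> i j; rewrite mul_perm_repr_mx mxE enum_rankK.
pose k := enum_rank (gset_act T (enum_val j) g^-1%g).
have kg : gset_act T (enum_val k) g = enum_val j.
  by rewrite enum_rankK -actMin ?groupV // mulVg act1.
rewrite mxE (bigD1 k) //= big1 => [|l nkl].
  by rewrite !mxE kg eqxx mulr1 addr0 -kg aS.
rewrite !mxE; case: eqP => [e|_]; last by rewrite mulr0.
move: nkl; rewrite -(inj_eq enum_val_inj) -(inj_eq (act_inj (gset_act T) g)).
by rewrite e kg eqxx.
Qed.

Hypothesis T_trans : forall x y : T, exists2 g, g \in S & gset_act T x g = y.

(* The left kernel of [A] is a module for a p-group in characteristic p, so it
   would contain a nonzero fixed, hence constant, vector. *)
Lemma transitive_det_neq0 y : \sum_x a x y != 0 -> \det A != 0.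
Proof.
move=> sum_a; have : A \in unitmx; last by rewrite unitmxE unitfE.
rewrite -row_free_unit -kermx_eq0; apply/negPn/negP => kerA0.
have modK : mxmodule perm_representation (kermx A).
  apply/mxmoduleP => g Sg; apply/sub_kermxP.
  by rewrite -mulmxA perm_repr_mxC // mulmxA mulmx_ker mul0mx.
have rk0 : (0 < \rank (kermx A))%N by rewrite lt0n mxrank_eq0.
have := rfix_pgroup_pchar charF (submod_repr modK) rk0 pS (fintype.subxx _).
case/rowV0Pn => w /rfix_mxP wS nz_w.
have [v [nz_v vS vA]] : exists v : 'rV_#|T|,
    [/\ v != 0, forall g, g \in S -> v *m perm_repr_mx g = v & v *m A = 0].
  exists (val_submod w); split; first by rewrite val_submod_eq0.
    move=> g Sg.
    by rewrite -[perm_repr_mx g]/(perm_representation g) -val_submodJ // wS.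
  exact/sub_kermxP/val_submodP.
have v_const i j : v 0 i = v 0 j.
  have [g Sg e] := T_trans (enum_val i) (enum_val j).
  rewrite -[in RHS](vS g Sg) mxE (bigD1 i) //= big1 => [|k nki].
    by rewrite mxE e eqxx mulr1 addr0.
  rewrite mxE -e (inj_eq (act_inj (gset_act T) g)) (inj_eq enum_val_inj).
  by rewrite (negPf nki) mulr0.
case/eqP: nz_v; apply/rowP=> i; rewrite [RHS]mxE.
have := congr1 (fun B : 'rV_#|T| => B 0 (enum_rank y)) vA.
rewrite [RHS]mxE mxE (eq_bigr (fun j => v 0 i * a (enum_val j) y)) => [|j _].
  rewrite -mulr_sumr -(big_enum_val (fun x => a x y)) => /eqP.
  by rewrite mulf_eq0 (negPf sum_a) orbF => /eqP.
by rewrite mxE enum_rankK (v_const j i).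
Qed.

End TransitiveMatrix.

Section Indecomposable.
Local Open Scope ring_scope.
Variables (O : comUnitRingType) (F : fieldType) (p : nat) (red : {rmorphism O -> F}).
Variables (gT : finGroupType) (S : {group gT}).
Hypotheses (charF : p \in [pchar F]) (pS : (p.-group S)%g).
Hypothesis red_unit : forall a, red a != 0 -> a \is a GRing.unit.

(** The determinant of the matrix of [f] has nonzero reduction, hence is a unit of [O]; the inverse
    matrix gives [f']. *)
Lemma transitive_endo_inv (T : gset S) (f : permMod O T -> permMod O T) y :
    (forall x z : T, exists2 g, g \in S & gset_act T x g = z) -> linear f ->
    {in S, forall g v, f (ogm_act v g) = ogm_act (f v) g} ->
    red (\sum_x f (dlt O x) y) != 0 ->
  exists f' : permMod O T -> permMod O T, cancel f f' /\ cancel f' f.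
Proof.
move=> T_trans lf fS sum_f.
have aS := permMod_lin_coef lf fS.
pose A := \matrix_(i < #|T|, j < #|T|) (f (dlt O (enum_val i)) (enum_val j) : O).
pose a x z := red (f (dlt O x) z).
have raS : {in S, forall g x z, a (gset_act T x g) (gset_act T z g) = a x z}.
  by move=> g Sg x z; rewrite /a aS.
have A_unit : A \in unitmx.
  rewrite unitmxE; apply: red_unit; rewrite -det_map_mx.
  have -> : map_mx red A = \matrix_(i < #|T|, j < #|T|) a (enum_val i) (enum_val j).
    by apply/matrixP=> i j; rewrite !mxE.
  apply: (transitive_det_neq0 charF pS raS T_trans (y := y)).
  by rewrite rmorph_sum in sum_f.
have prodE (B C : 'M[O]_#|T|) x z : B *m C = 1%:M ->
    \sum_y B (enum_rank x) (enum_rank y) * C (enum_rank y) (enum_rank z) = (x == z)%:R.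
  move/(congr1 (fun D : 'M_#|T| => D (enum_rank x) (enum_rank z))).
  rewrite !mxE (inj_eq enum_rank_inj) => <-.
  rewrite (reindex_onto enum_val enum_rank) /=; last by move=> ? _; exact: enum_rankK.
  by apply: eq_big => [i|i _]; rewrite enum_valK ?eqxx.
have AE x z : f (dlt O x) z = A (enum_rank x) (enum_rank z).
  by rewrite !mxE !enum_rankK.
pose b x z := invmx A (enum_rank x) (enum_rank z).
have fE v : f v = mxapp (fun x z => f (dlt O x) z) v.
  rewrite {1}[v]dlt_sum (lin_sum _ _ lf); apply/ffunP=> z.
  by rewrite sum_ffunE ffunE; apply: eq_bigr => x _; rewrite ffunE.
have id_app (c : T -> T -> O) : (forall x z, c x z = (x == z)%:R) ->
    forall v, mxapp c v = v.
  move=> cE v; rewrite -[RHS]mxapp_id; congr (mxapp _ v).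
  by apply/funext=> x; apply/funext=> z.
exists (mxapp b); split=> v; rewrite fE mxapp_mul; apply: id_app => x z.
- by rewrite -(prodE _ _ x z (mulmxV A_unit)); apply: eq_bigr => y' _; rewrite AE.
- by rewrite -(prodE _ _ x z (mulVmx A_unit)); apply: eq_bigr => y' _; rewrite AE.
Qed.

Lemma gset_orbit_trans (X : gset S) (x : X) (u v : gset_orbit x) :
  exists2 g, g \in S & gset_act (gset_orbit x) u g = v.
Proof.
have /orbitP[g Sg eu] := valP u; have /orbitP[h Sh ev] := valP v.
exists (g^-1 * h)%g; first by rewrite groupM ?groupV.
apply: val_inj; rewrite val_gset_sub ?groupM ?groupV // -eu -ev.
by rewrite -actMin ?groupM ?groupV // mulKVg.
Qed.

(** Krull-Schmidt for the modules O[S/Q], whose endomorphism rings are local. *)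
Theorem summand_permMod (M N : ogmod O S) (X : gset S) :
  ogiso (ogm_dsum M N) (permMod O X) -> exists Y : gset S, ogiso M (permMod O Y).
Proof.
have [n] := ubnP #|X|; elim: n X M N => // n IHn X M N leXn iX.
case: (pickP X) => [x0 _|X0]; last first.
  exists X; have [f [_ [f' fK _] _]] := iX.
  have v0 (v w : permMod O X) : v = w by apply/ffunP=> z; have := X0 z.
  apply: (@ogisoI _ _ _ M (permMod O X) (fun=> 0) (fun=> 0)) => [a v w|m|v|g Sg m].
  - by rewrite scaler0 addr0.
  - by have /(can_inj fK)[] := v0 (f (0, 0)) (f (m, 0)).
  - exact: v0.
  - exact: v0.
pose T := gset_orbit x0; pose R := gset_rest x0.
have leR : (#|R| < n)%N := leq_trans (card_gset_rest x0) leXn.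
have := ogiso_trans iX (ogiso_trans (permMod_iso O (gset_orbit_split x0))
  (permMod_sum O T R)).
case/ogiso_inv=> phi [psi [[lphi lpsi] [phiK psiK] phiS psiS]].
(* The identity of the module on [T] is the sum of [u], factoring through [M], and [u'], factoring
   through [N]. *)
pose u (v : permMod O T) : permMod O T := (phi ((psi (v, 0)).1, 0)).1.
pose u' (v : permMod O T) : permMod O T := (phi (0, (psi (v, 0)).2)).1.
have lu : linear u by move=> a v w; rewrite /u pairL lpsi /= pairL lphi.
have lu' : linear u' by move=> a v w; rewrite /u' pairL lpsi /= pairR lphi.
have psi0 g (v : permMod O T) : g \in S ->
    psi (ogm_act v g, 0) = ogm_act (psi (v, 0)) g.
  by move=> Sg; rewrite ogm_act_pairl // psiS.
have uS : {in S, forall g v, u (ogm_act v g) = ogm_act (u v) g}.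
  move=> g Sg v; rewrite /u psi0 //.
  rewrite -[(ogm_act (psi (v, 0)) g).1]/(ogm_act (psi (v, 0)).1 g).
  by rewrite ogm_act_pairl // phiS.
have u'S : {in S, forall g v, u' (ogm_act v g) = ogm_act (u' v) g}.
  move=> g Sg v; rewrite /u' psi0 //.
  rewrite -[(ogm_act (psi (v, 0)) g).2]/(ogm_act (psi (v, 0)).2 g).
  by rewrite ogm_act_pairr // phiS.
have uu' v : u v + u' v = v.
  transitivity (phi ((psi (v, 0)).1, (psi (v, 0)).2)).1.
    by rewrite [((psi (v, 0)).1, (psi (v, 0)).2)]pairLR (linD _ _ lphi).
  by rewrite -surjective_pairing psiK.
pose y0 : T := exist (fun z => z \in orbit _ S _) x0 (orbit_refl (gset_act X) S x0).
have sum1 : \sum_x u (dlt O x) y0 + \sum_x u' (dlt O x) y0 = 1.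
  rewrite -big_split (bigD1 y0) //= big1 => [|x nx].
    have := congr1 (fun v : permMod O T => v y0) (uu' (dlt O y0)).
    by rewrite !ffunE eqxx addr0.
  have := congr1 (fun v : permMod O T => v y0) (uu' (dlt O x)).
  by rewrite !ffunE (negPf nx).
have trans := @gset_orbit_trans X x0.
(* The two column sums add to 1, so one is nonzero in [F] and that endomorphism is invertible. *)
have [e0|nz] := eqVneq (red (\sum_x u (dlt O x) y0)) 0; last first.
  have [w [wK Kw]] := transitive_endo_inv trans lu uS nz.
  have [K [iM iR]] := ogm_exchange lphi phiK psiK phiS wK Kw.
  have [Y iK] := IHn _ _ _ leR iR.
  exists (gset_sum T Y); apply: (ogiso_trans iM).
  apply: (ogiso_trans _ (ogiso_sym (permMod_sum O T Y))).
  exact: ogm_dsum_iso (ogiso_refl _) iK.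
have nz : red (\sum_x u' (dlt O x) y0) != 0.
  have := congr1 red sum1; rewrite rmorphD e0 add0r rmorph1 => ->.
  exact: oner_neq0.
have [w [wK Kw]] := transitive_endo_inv trans lu' u'S nz.
(* Exchanging [M] and [N] makes [M] a summand of the module on [R], where induction applies
   directly. *)
pose sw (A B : ogmod O S) (z : A * B) : B * A := (z.2, z.1).
have [] := @ogm_exchange O gT S N M (permMod O T) (permMod O R)
  (phi \o @sw N M) (@sw M N \o psi) w _ _ _ _ wK Kw.
- by move=> a y z; rewrite -lphi.
- by move=> [y z]; rewrite /= /sw phiK.
- by move=> y; rewrite /= /sw /= -surjective_pairing psiK.
- by move=> g Sg [y z]; apply: (phiS g Sg (z, y)).
move=> K [_ iR]; apply: IHn leR _.
exact: ogiso_trans (ogm_dsumC _ _) iR.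
Qed.

End Indecomposable.

(** * The trivial source ring of a p-group and restriction to S *)

Section TrivialSourceSylow.
Local Open Scope ring_scope.

(** A nonzero residue forces valuation at most 0, so the inverse in [K] has nonnegative valuation
    and lies in [O]. *)
Lemma pms_unit (K : fieldType) (O : idomainType) (F : fieldType) (p : nat)
    (iota : {rmorphism O -> K}) (red : {rmorphism O -> F}) :
  p_modular_system p iota red -> forall a, red a != 0 -> a \is a GRing.unit.
Proof.
move=> pms a nz_ra; have [v [dv vO vm _]] := pms_val pms.
have nz_ia : iota a != 0.
  by apply: contraNneq nz_ra => ia0; apply/eqP/vm; left.
have v1 : v 1 = 0.
  have := dv_mul dv (oner_neq0 K) (oner_neq0 K); rewrite mulr1 => /eqP.
  by rewrite -subr_eq0 opprD addNKr oppr_eq0 => /eqP.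
have va : v (iota a) <= 0.
  rewrite leNgt; apply: contra nz_ra => va_gt0; apply/eqP/vm; right.
  by rewrite -gtz0_ge1.
have [b ib] : exists b, (iota a)^-1 = iota b.
  apply/vO; right; have := dv_mul dv nz_ia (invr_neq0 nz_ia).
  rewrite mulfV // v1 => /esym/eqP; rewrite addr_eq0 => /eqP.
  by move=> e; rewrite -oppr_le0 -e.
apply/unitrPr; exists b; apply: (pms_inj pms).
by rewrite rmorphM -ib mulfV // rmorph1.
Qed.

Variables (O : comUnitRingType) (F : fieldType) (p : nat) (red : {rmorphism O -> F}).
Variables (gT : finGroupType) (G S : {group gT}).
Hypotheses (charF : p \in [pchar F]).
Hypothesis red_unit : forall a, red a != 0 -> a \is a GRing.unit.

Lemma gcls_pperm_pgroup (M : pperm O S) : (p.-group S)%g -> exists X : gset S,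
  ogiso M (permMod O X) /\
  (gcls (M : pperm_rig O S) : trivial_source O S) = lam O S (@gcls (gset_rig S) X).
Proof.
move=> pS; have [_ [X [N iX]]] := pp_modP M.
have [Y iY] := summand_permMod charF pS red_unit iX.
by exists Y; split=> //; rewrite lamE; apply: gcls_iso.
Qed.

Lemma lam_surj (x : trivial_source O S) : (p.-group S)%g -> exists a, lam O S a = x.
Proof.
move=> pS; have [M [N ->]] := gclsBE x.
have [X [_ ->]] := gcls_pperm_pgroup M pS; have [Y [_ ->]] := gcls_pperm_pgroup N pS.
by exists (@gcls (gset_rig S) X - @gcls (gset_rig S) Y); rewrite rmorphB.
Qed.

Lemma lam_res (sSG : S \subset G) (a : burnside G) :
  trivial_source_res O sSG (lam O G a) = lam O S (burnside_res sSG a).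
Proof.
have lam_resX (X : gset G) : trivial_source_res O sSG (lam O G (@gcls (gset_rig G) X))
    = lam O S (burnside_res sSG (@gcls (gset_rig G) X)).
  rewrite lamE trivial_source_resE burnside_resE lamE.
  by apply: gcls_iso; apply: ogm_res_perm.
have [X [Y ->]] := gclsBE a; rewrite (rmorphB (lam O G)) (rmorphB (burnside_res sSG)).
by rewrite (rmorphB (lam O S)) (rmorphB (trivial_source_res O sSG)) !lam_resX.
Qed.

Variables (sSG : S \subset G) (pS : (p.-group S)%g).

(** A module restricted to [S] is a permutation module on some [X], whose class [lamSinv] returns;
    its marks are stable because [G] acts on the original module. *)
Lemma lam_inv_res_stable (lamSinv : {rmorphism trivial_source O S -> burnside S}) x :
  cancel (lam O S) lamSinv ->
  lamSinv (trivial_source_res O sSG x) \in fusion_stable G (S := S).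
Proof.
move=> lamK; have [M [N ->]] := gclsBE x.
suff stabM (L : pperm O G) :
    lamSinv (trivial_source_res O sSG (gcls (L : pperm_rig O G))) \in fusion_stable G (S := S).
  by rewrite (rmorphB (trivial_source_res O sSG)) rmorphB; apply: rpredB; apply: stabM.
rewrite trivial_source_resE.
have [X [iX ->]] := gcls_pperm_pgroup (pp_res sSG L) pS; rewrite lamK.
apply/asboolP => P Q sPS sQS [g Gg eQ]; rewrite !markE //; congr (_%:R).
have sPgS : (P :^ g)%g \subset S by move: sQS; rewrite eQ.
by rewrite (card_fix_res_conj red charF iX (pgroupS sPS pS) sPS Gg sPgS) eQ.
Qed.

End TrivialSourceSylow.

(** * The transfer and the decompositions of B(G) and T(OG) *)

Local Open Scope classical_set_scope.

Theorem theoremB (gT : finGroupType) (G S : {group gT}) (p : nat)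
    (K : fieldType) (O : idomainType) (F : fieldType)
    (iota : {rmorphism O -> K}) (red : {rmorphism O -> F})
    (p_pr : prime p) (pms : p_modular_system p iota red)
    (sylS : (p.-Sylow(G) S)%g) :
  exists lamSinv : {rmorphism trivial_source O S -> burnside S},
  [/\ cancel (lam O S) lamSinv, cancel lamSinv (lam O S) &
  exists t : {rmorphism burnside_fusion G S -> burnside G},
  [/\ forall a, burnside_resF (pHall_sub sylS) (t a) = a,
      forall a, lamSinv (trivial_source_res O (pHall_sub sylS) (lam O G (t a)))
                = bf_val a,
      ideal_subring_decomposition (burnside_fusion G S)
        (ring_ker (burnside_res (pHall_sub sylS)))
        (range t) &
      ideal_subring_decomposition (burnside_fusion G S)
        (ring_ker (lamSinv \o trivial_source_res O (pHall_sub sylS)))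
        (range (lam O G \o t))]].
Proof.
have charF := pms_charF pms; have red_unit := pms_unit pms.
have pS := pHall_pgroup sylS; set sSG := pHall_sub sylS.
have [lamSinv [lamK lamSinvK]] := bij_rmorphism (lam_inj red charF pS)
  (fun x => lam_surj charF red_unit x pS).
pose t := burnside_transfer sylS.
have resFK a : burnside_resF sSG (t a) = a by apply: burnside_resFK.
have resK a : burnside_res sSG (t a) = bf_val a by rewrite -[in RHS](resFK a).
have lamresK a : lamSinv (trivial_source_res O sSG (lam O G (t a))) = bf_val a.
  by rewrite lam_res lamK resK.
pose v : {rmorphism burnside_fusion G S -> burnside S} := val.
have v_inj : injective v := val_inj.
exists lamSinv; split=> //; exists t; split=> //.
  apply: (section_decomposition (v := v)) => // x.
  by exists (burnside_resF sSG x).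
apply: (section_decomposition_comp (v := v)); first exact: v_inj.
  exact: lamresK.
move=> x.
(* Stability puts the image of every [x] of T(OG) in B(F), as the decomposition requires. *)
by exists (BurnsideFusion (lam_inv_res_stable charF red_unit sSG pS x lamK)).
Qed.
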